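(* Let $K\geq 2$ be an integer and let ${\bf C}^{(1)},\dots,{\bf C}^{(K)}$ be $K$ independent simple random walks on the 2-dimensional comb lattice $\mathbb{C}^2$, all starting from $(0,0)$. Let $D_K^{\mathbb{C}^2}(n)=\max_{i\neq j,\ i,j\leq K} d({\bf C}^{(i)}(n),{\bf C}^{(j)}(n))$, where $d$ is the graph distance on $\mathbb{C}^2$. Then $$\limsup_{n\to\infty}\frac{D_K^{\mathbb{C}^2}(n)}{2\sqrt{n\log\log n}}=1\quad\text{a.s.}$$
   Context: The 2-dimensional comb lattice $\mathbb{C}^2$ is the graph obtained from the nearest-neighbour lattice $\mathbb{Z}^2$ by removing all horizontal edges off the $x$-axis. The simple random walk ${\bf C}(n)=(C_1(n),C_2(n))$ on $\mathbb{C}^2$ has transition probabilities $P({\bf C}(n+1)=(x,y\pm1)\mid{\bf C}(n)=(x,y))=\frac12$ if $y\neq0$, and $P({\bf C}(n+1)=(x\pm1,0)\mid{\bf C}(n)=(x,0))=P({\bf C}(n+1)=(x,\pm1)\mid{\bf C}(n)=(x,0))=\frac14$ (each of the indicated neighbours having the given probability). The graph distance $d(u,v)$ is the length of the shortest path in $\mathbb{C}^2$ from $u$ to $v$. *)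

(* Defs.v *)
From HB Require Import structures.
From mathcomp Require Import all_boot all_order all_algebra.
From mathcomp Require Import all_classical all_reals all_analysis.
From mathcomp Require Import zify.

Set Implicit Arguments.
Unset Strict Implicit.
Unset Printing Implicit Defensive.

Import Order.TTheory GRing.Theory Num.Theory.

Local Open Scope classical_set_scope.
Local Open Scope ring_scope.

Definition vertex : Type := (int * int)%type.

Definition lattice_edge : rel vertex :=
  fun u v => (`|u.1 - v.1| + `|u.2 - v.2| == 1 :> int).

Definition comb_edge : rel vertex := fun u v =>
  lattice_edge u v && ~~ ((u.2 == v.2) && (u.2 != 0)).

(* There is a path of length n from u to v: u followed by the n vertices of p. *)
Definition comb_path (u v : vertex) (n : nat) : Prop :=
  exists p : seq vertex, [/\ path comb_edge u p, last u p = v & size p = n].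

Lemma comb_path_cat u v w m n :
  comb_path u v m -> comb_path v w n -> comb_path u w (m + n).
Proof.
move=> [p [pp <- <-]] [q [qq <- <-]]; exists (p ++ q).
by rewrite cat_path pp qq last_cat size_cat.
Qed.

Lemma comb_edge_sym : symmetric comb_edge.
Proof.
move=> [a b] [c d]; rewrite /comb_edge /lattice_edge /=.
by rewrite distrC [`|b - d|]distrC (eq_sym d); case: (eqVneq b d) => // ->.
Qed.

Lemma comb_path_sym u v n : comb_path u v n -> comb_path v u n.
Proof.
move=> [p [pp <- <-]]; exists (rev (belast u p)).
split; last by rewrite size_rev size_belast.
- by rewrite rev_path (eq_path (e' := comb_edge)) // => a b; rewrite comb_edge_sym.
- by case: p {pp} => [|a p] //=; rewrite rev_cons last_rcons.
Qed.

Lemma comb_path_vert (x y : int) : exists n, comb_path (x, 0) (x, y) n.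
Proof.
suff H (e : int) (k : nat) : e = 1 \/ e = -1 ->
    comb_path (x, 0) (x, e * k%:Z) k.
  exists `|y|%N; case: (intP y) => [|k|k].
  - by exists [::].
  - by have := H 1 k.+1 (or_introl erefl); rewrite mul1r.
  - by have := H (-1) k.+1 (or_intror erefl); rewrite mulN1r abszN.
move=> he; elim: k => [|k IH]; first by exists [::]; rewrite mulr0.
rewrite -addn1; apply: comb_path_cat IH _; exists [:: (x, e * (k + 1)%N%:Z)].
split=> //=; rewrite andbT /comb_edge /lattice_edge /=.
by case: he => ->; lia.
Qed.

Lemma comb_path_horiz (x : int) : exists n, comb_path (0, 0) (x, 0) n.
Proof.
suff H (e : int) (k : nat) : e = 1 \/ e = -1 ->
    comb_path (0, 0) (e * k%:Z, 0) k.
  exists `|x|%N; case: (intP x) => [|k|k].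
  - by exists [::].
  - by have := H 1 k.+1 (or_introl erefl); rewrite mul1r.
  - by have := H (-1) k.+1 (or_intror erefl); rewrite mulN1r abszN.
move=> he; elim: k => [|k IH]; first by exists [::]; rewrite mulr0.
rewrite -addn1; apply: comb_path_cat IH _; exists [:: (e * (k + 1)%N%:Z, 0)].
split=> //=; rewrite andbT /comb_edge /lattice_edge /=.
by case: he => ->; lia.
Qed.

Lemma comb_connected (u v : vertex) : exists n, `[< comb_path u v n >].
Proof.
have H (z : vertex) : exists n, comb_path (0, 0) z n.
  case: z => x y; have [m hm] := comb_path_horiz x.
  have [n hn] := comb_path_vert x y.
  by exists (m + n)%N; apply: comb_path_cat hm hn.
have [m hm] := H u; have [n hn] := H v.
by exists (m + n)%N; apply/asboolP/(comb_path_cat (comb_path_sym hm) hn).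
Qed.

Definition comb_dist (u v : vertex) : nat := ex_minn (comb_connected u v).

Definition comb_step (R : realType) (u v : vertex) : R :=
  if comb_edge u v then (if u.2 == 0 then 4^-1 else 2^-1) else 0.

Section processes.
Context (d : measure_display) (T : measurableType d) (R : realType).
Variable P : probability T R.

Definition cond_prob (A B : set T) : R := fine (P (A `&` B)) / fine (P B).

Definition history (X : nat -> T -> vertex) (n : nat) (w : nat -> vertex) :
    set T :=
  [set t | forall k, (k <= n)%N -> X k t = w k].

(* Vertices carry the discrete sigma-algebra. The transition law is imposed
   conditionally on the whole past, which includes the Markov property. *)
Definition comb_walk (X : nat -> T -> vertex) : Prop :=
  [/\ forall n (B : set vertex), measurable (X n @^-1` B),
      P [set t | X 0%N t = (0, 0)] = 1%E
    & forall n (w : nat -> vertex), P (history X n w) != 0%E ->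
        cond_prob [set t | X n.+1 t = w n.+1] (history X n w)
          = comb_step R (w n) (w n.+1)].

Definition process_events (X : nat -> T -> vertex) : set (set T) :=
  <<s [set A | exists n (B : set vertex), A = X n @^-1` B] >>.

Definition independent_processes (I : finType) (X : I -> nat -> T -> vertex) :
    Prop :=
  forall (J : {set I}) (A : I -> set T),
    (forall i, i \in J -> process_events (X i) (A i)) ->
    P (\bigcap_(i in [set i | i \in J]) A i) = (\prod_(i in J) P (A i))%E.

End processes.

Definition max_dist (T : Type) (K : nat) (C : 'I_K -> nat -> T -> vertex)
    (n : nat) (t : T) : nat :=
  \max_(ij : 'I_K * 'I_K | ij.1 != ij.2) comb_dist (C ij.1 n t) (C ij.2 n t).

(* Main.v *)
Require Import Defs.
From HB Require Import structures.
From mathcomp Require Import all_boot all_order all_algebra.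
From mathcomp Require Import all_classical all_reals all_analysis.
From mathcomp Require Import zify ring lra.

Set Implicit Arguments.
Unset Strict Implicit.
Unset Printing Implicit Defensive.

Import Order.TTheory GRing.Theory Num.Theory.
Import numFieldNormedType.Exports.

Local Open Scope classical_set_scope.
Local Open Scope ring_scope.

(* Every step of the comb walk changes exactly one coordinate by one, upwards
   and downwards with equal probability; hence each signed sum
   [+-C_1(n) +- C_2(n)] is exactly a simple random walk on the integers. The
   graph distance lies between the l1 distance on the lattice and the sum of
   the l1 norms, so the distance of two walks is at least
   [(C_1 + C_2) - (C'_1 + C'_2)] and at most the maximum of the sixteen
   differences of signed sums. Each of these differences is a simple random
   walk observed at time [2n]: its fair coins are the steps of the two walks,
   interleaved. The claim is therefore the law of the iterated logarithm for
   fair coins at even times. Its upper half is the exponential maximal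
   inequality along a geometric grid of times; its lower half is an exponential
   change of measure for the increments over geometric blocks, together with
   the independence of these blocks. *)

(** * Exponential bounds on the hyperbolic cosine *)

Section hyperbolic.
Context {R : realType}.
Implicit Types x y : R.

Definition cosh x := (expR x + expR (- x)) / 2.
Definition sinh x := (expR x - expR (- x)) / 2.

Lemma is_derive_cosh x : is_derive x 1 cosh (sinh x).
Proof.
rewrite /cosh; apply: is_derive_eq.
rewrite /sinh /GRing.scale /=; ring.
Qed.

Lemma is_derive_sinh x : is_derive x 1 sinh (cosh x).
Proof.
rewrite /sinh; apply: is_derive_eq.
rewrite /cosh /GRing.scale /=; ring.
Qed.

(** Mean value theorem. The bounds below climb by repeated use of it: each inequality says that the
    derivative in the next one is nonnegative. *)
Lemma nonneg_derive_ge (f g : R -> R) x : 0 <= x ->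
  (forall y, is_derive y 1 f (g y)) -> (forall y, 0 <= y -> 0 <= g y) ->
  f 0 <= f x.
Proof.
move=> x0 df g0.
have fc : {within `[0, x], continuous f}.
  apply: continuous_subspaceT => y; apply: differentiable_continuous.
  by apply/derivable1_diffP; case: (df y).
have [c + E] := MVT_segment x0 (fun y _ => df y) fc.
rewrite in_itv /= => /andP[c0 _].
by rewrite -subr_ge0 E mulr_ge0 ?subr_ge0 // g0.
Qed.

Lemma cosh_gt0 x : 0 < cosh x.
Proof. by rewrite divr_gt0 // addr_gt0 // expR_gt0. Qed.

Lemma coshN x : cosh (- x) = cosh x.
Proof. by rewrite /cosh opprK addrC. Qed.

Lemma sinh_ge0 x : 0 <= x -> 0 <= sinh x.
Proof.
move=> x0; rewrite divr_ge0 // subr_ge0 ler_expR; lra.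
Qed.

Lemma cosh_ge1 x : 0 <= x -> 1 <= cosh x.
Proof.
move=> x0; have <- : cosh 0 = 1 by rewrite /cosh oppr0 expR0; lra.
exact: nonneg_derive_ge x0 is_derive_cosh sinh_ge0.
Qed.

Lemma sinh_ge_id x : 0 <= x -> x <= sinh x.
Proof.
move=> x0; rewrite -subr_ge0.
have -> : 0 = (fun y => sinh y - y) 0 by rewrite /= /sinh oppr0; lra.
apply: (@nonneg_derive_ge (fun y => sinh y - y) (fun y => cosh y - 1)) => //.
- by move=> y; have := is_derive_sinh; move=> ?; apply: is_derive_eq.
- by move=> y y0; rewrite subr_ge0 cosh_ge1.
Qed.

Lemma cosh_ge_quad x : 0 <= x -> 1 + x ^+ 2 / 2 <= cosh x.
Proof.
move=> x0; rewrite -subr_ge0.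
have -> : 0 = (fun y => cosh y - (1 + y ^+ 2 / 2)) 0.
  by rewrite /= /cosh oppr0 expR0; lra.
apply: (@nonneg_derive_ge (fun y => cosh y - (1 + y ^+ 2 / 2))
  (fun y => sinh y - y)) => //.
- move=> y; have := is_derive_cosh; move=> ?; apply: is_derive_eq.
  by rewrite /GRing.scale /=; lra.
- by move=> y y0; rewrite subr_ge0 sinh_ge_id.
Qed.

Lemma sinh_le_cosh x : 0 <= x -> sinh x <= x * cosh x.
Proof.
move=> x0; rewrite -subr_ge0.
have -> : 0 = (fun y => y * cosh y - sinh y) 0.
  by rewrite /= /sinh oppr0; lra.
apply: (@nonneg_derive_ge (fun y => y * cosh y - sinh y)
  (fun y => y * sinh y)) => //.
- move=> y; have := is_derive_cosh; have := is_derive_sinh.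
  by move=> ? ?; apply: is_derive_eq; rewrite /GRing.scale /=; lra.
- by move=> y y0; rewrite mulr_ge0 // sinh_ge0.
Qed.

(** By parity take [0 <= x]; then [cosh y * expR (- y^2 / 2)] is nonincreasing, because
    [sinh y <= y * cosh y], and equals [1] at [0]. *)
Lemma cosh_le x : cosh x <= expR (x ^+ 2 / 2).
Proof.
wlog x0 : x / 0 <= x.
  move=> H; have [/H//|/ltW x0] := leP 0 x.
  by rewrite -coshN -sqrrN; apply: H; lra.
pose f y : R := - (cosh y * expR (- (y ^+ 2 / 2))).
have : f 0 <= f x.
  apply: (@nonneg_derive_ge f
    (fun y => (y * cosh y - sinh y) * expR (- (y ^+ 2 / 2)))) => //.
  - move=> y; have := is_derive_cosh; move=> ?; apply: is_derive_eq.
    by rewrite /GRing.scale /=; field.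
  - by move=> y y0; rewrite mulr_ge0 ?expR_ge0 // subr_ge0 sinh_le_cosh.
rewrite /f lerN2 {2}/cosh oppr0 expR0 expr0n /= mul0r oppr0 expR0 expRN.
by rewrite ler_pdivrMr ?expR_gt0 //; lra.
Qed.

(** With [u = x^2 / 2] the chain is [expR (u - u^2) <= expR (u / (1 + u)) <= 1 + u <= cosh x]; its
    middle step is [1 - v <= expR (- v)] at [v = u / (1 + u)]. *)
Lemma cosh_ge x : 0 <= x -> expR (x ^+ 2 / 2 - x ^+ 4 / 4) <= cosh x.
Proof.
move=> x0; apply: le_trans (cosh_ge_quad x0).
set u := x ^+ 2 / 2; have u0 : 0 <= u by rewrite /u divr_ge0 // sqr_ge0.
have -> : x ^+ 4 / 4 = u ^+ 2 by rewrite /u; field.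
apply: (@le_trans _ _ (expR (u / (1 + u)))).
  rewrite ler_expR ler_pdivlMr; last lra.
  have -> : (u - u ^+ 2) * (1 + u) = u - u ^+ 3 by ring.
  have : 0 <= u ^+ 3 by exact: exprn_ge0.
  lra.
have := expR_ge1Dx (- (u / (1 + u))); rewrite expRN.
have -> : 1 - u / (1 + u) = (1 + u)^-1 by field; lra.
by rewrite lef_pV2 // posrE ?expR_gt0 //; lra.
Qed.

End hyperbolic.

Lemma expR_ge1 {R : realType} (x : R) : 0 <= x -> 1 <= expR x.
Proof. by move=> x0; apply: le_trans (expR_ge1Dx _); lra. Qed.

(** * Averages over finite coin sequences *)

Section coin_average.
Context {R : realType}.
Implicit Types (f g : seq bool -> R) (s : seq bool) (n m : nat).

(** The expectation over [n] independent fair tosses. Recursion on the first toss turns first-step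
    analysis into plain induction. *)
Fixpoint coin_avg n f : R :=
  if n is m.+1 then
    (coin_avg m (f \o cons true) + coin_avg m (f \o cons false)) / 2
  else f [::].

Lemma eq_coin_avg n f g :
  (forall s, size s = n -> f s = g s) -> coin_avg n f = coin_avg n g.
Proof.
elim: n f g => [|n IH] f g fg /=; first exact: fg.
by congr ((_ + _) / _); apply: IH => s sn; apply: fg; rewrite /= sn.
Qed.

Lemma le_coin_avg n f g :
  (forall s, size s = n -> f s <= g s) -> coin_avg n f <= coin_avg n g.
Proof.
elim: n f g => [|n IH] f g fg /=; first exact: fg.
rewrite ler_pM2r ?invr_gt0 // lerD // IH // => s sn;
  by apply: fg; rewrite /= sn.
Qed.

Lemma coin_avgD n f g :
  coin_avg n (fun s => f s + g s) = coin_avg n f + coin_avg n g.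
Proof.
elim: n f g => [|n IH] f g //=.
by rewrite -mulrDl addrACA -!IH.
Qed.

Lemma coin_avgZ n (a : R) f :
  coin_avg n (fun s => a * f s) = a * coin_avg n f.
Proof. by elim: n f => [|n IH] f //=; rewrite mulrA mulrDr -!IH. Qed.

Lemma coin_avg_cst n (a : R) : coin_avg n (fun=> a) = a.
Proof.
elim: n => [|n IH] //=.
by rewrite -[_ \o _]/(fun=> a) -[X in _ + coin_avg n X]/(fun=> a) IH; lra.
Qed.

Lemma coin_avg_ge0 n f :
  (forall s, size s = n -> 0 <= f s) -> 0 <= coin_avg n f.
Proof. by move=> f0; rewrite -(coin_avg_cst n 0) le_coin_avg. Qed.

Lemma coin_avg_le1 n f :
  (forall s, size s = n -> f s <= 1) -> coin_avg n f <= 1.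
Proof. by move=> f0; rewrite -[leRHS](coin_avg_cst n 1) le_coin_avg. Qed.

(** Independence of the first [m] tosses from the next [n]. *)
Lemma coin_avg_cat m n f g :
  coin_avg (m + n) (fun s => f (take m s) * g (drop m s))
  = coin_avg m f * coin_avg n g.
Proof.
elim: m f => [|m IH] f /=.
  rewrite -coin_avgZ; apply: eq_coin_avg => s _.
  by rewrite take0 drop0.
by rewrite mulrAC [in RHS]mulrDl -!IH.
Qed.

Definition coin_sign (b : bool) : R := if b then 1 else -1.

Definition coin_walk s : R := \sum_(b <- s) coin_sign b.

Lemma coin_walk_cons b s : coin_walk (b :: s) = coin_sign b + coin_walk s.
Proof. by rewrite /coin_walk big_cons. Qed.

Lemma coin_walk_cat s1 s2 :
  coin_walk (s1 ++ s2) = coin_walk s1 + coin_walk s2.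
Proof. by rewrite /coin_walk big_cat. Qed.

Lemma coin_avg_expR n (l : R) :
  coin_avg n (fun s => expR (l * coin_walk s)) = cosh l ^+ n.
Proof.
elim: n => [|n IH] /=; first by rewrite /coin_walk big_nil mulr0 expR0.
rewrite exprS -IH /cosh [in RHS]mulrAC [in RHS]mulrDl -!coin_avgZ.
congr ((_ + _) / _); apply: eq_coin_avg => s _ /=;
  rewrite coin_walk_cons mulrDr expRD; congr (expR _ * _) => /=; ring.
Qed.

(** Tells whether some partial sum, the empty one included, reaches [a]. Lowering the level instead
    of carrying a running sum matches the recursion of [coin_avg]. *)
Fixpoint hits (a : R) s : bool :=
  (a <= 0) || (if s is b :: s' then hits (a - coin_sign b) s' else false).

Lemma hits_take a s k : a <= coin_walk (take k s) -> hits a s.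
Proof.
elim: s a k => [|b s IH] a k /=.
  by rewrite /coin_walk big_nil orbF.
case: k => [|k] /=; first by rewrite /coin_walk big_nil => ->.
rewrite coin_walk_cons => H; apply/orP; right; apply: (IH _ k); lra.
Qed.

(* The maximal inequality for the exponential martingale, by induction on the
   time: the bound is at least [1] once the level is reached. *)
Lemma coin_avg_hits_expR n (l a : R) : 0 <= l ->
  coin_avg n (fun s => (hits a s)%:R) <= expR (- (l * a)) * cosh l ^+ n.
Proof.
move=> l0; elim: n a => [|n IH] a; have [a0|a0] := leP a 0.
- rewrite /= a0 mulr1 expR_ge1 //; nra.
- by rewrite /= (leNgt a) a0 /= mulr1 expR_ge0.
- apply: (@le_trans _ _ 1).
    by apply: coin_avg_le1 => s _; case: hits.
  rewrite mulr_ege1 ?exprn_ege1 ?cosh_ge1 // expR_ge1 //; nra.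
(* The first toss moves the level to [a - 1] or [a + 1]; averaging the two bounds produces one more
   factor [cosh l]. *)
- have := lerD (IH (a - 1)) (IH (a + 1)).
  have E1 : expR (- (l * (a - 1))) = expR (- (l * a)) * expR l.
    by rewrite -expRD; congr expR; ring.
  have E2 : expR (- (l * (a + 1))) = expR (- (l * a)) * expR (- l).
    by rewrite -expRD; congr expR; ring.
  rewrite E1 E2 => H.
  have -> : expR (- (l * a)) * cosh l ^+ n.+1 =
      (expR (- (l * a)) * expR l * cosh l ^+ n +
       expR (- (l * a)) * expR (- l) * cosh l ^+ n) / 2.
    by rewrite exprS [in X in X * _ ^+ _]/cosh; ring.
  rewrite [leLHS]/= ler_pM2r ?invr_gt0 //; apply: le_trans H.
  rewrite le_eqVlt; apply/orP; left; apply/eqP.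
  by congr (_ + _); apply: eq_coin_avg => s _ /=; rewrite (leNgt a) a0 /= ?opprK.
Qed.

(** After [cosh l <= expR (l^2 / 2)] the exponent is [- l a + n l^2 / 2], which is least at
    [l = a / n]. *)
Lemma coin_avg_hits n (a : R) : 0 < a -> (0 < n)%N ->
  coin_avg n (fun s => (hits a s)%:R) <= expR (- (a ^+ 2 / (2 * n%:R))).
Proof.
move=> a0 n0; have n0' : 0 < n%:R :> R by rewrite ltr0n.
have l0 : 0 <= a / n%:R by rewrite divr_ge0 ?ltW.
apply: (le_trans (coin_avg_hits_expR n a l0)).
apply: (@le_trans _ _ (expR (- (a / n%:R * a)) *
    expR ((a / n%:R) ^+ 2 / 2) ^+ n)).
  by rewrite ler_pM2l ?expR_gt0 // lerXn2r ?nnegrE ?expR_ge0 ?cosh_le // ltW // cosh_gt0.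
rewrite -expRM_natl -expRD ler_expR.
rewrite le_eqVlt; apply/orP; left; apply/eqP; field; lra.
Qed.

(* Exponential change of measure: under the weight [expR (t * coin_walk s)]
   the walk concentrates near [n * t], and [k] is the relative tolerance. *)
Lemma coin_avg_tail n (t k : R) : 0 < t -> 0 < k < 1 ->
  n%:R * t ^+ 4 <= 1 -> 14 <= n%:R * t ^+ 2 * k ^+ 2 ->
  expR (- (n%:R * t ^+ 2 / 2 * (1 + 2 * k))) / 2 <=
  coin_avg n (fun s => (n%:R * t * (1 - k) <= coin_walk s)%R%:R).
Proof.
move=> t0 /andP[k0 k1] h1 h2.
set lo := n%:R * t * (1 - k); pose hi := n%:R * t * (1 + k).
set p := coin_avg _ _; pose V := n%:R * t ^+ 2.
(* The extra tilt [e = k t] minimises both error exponents, each of which becomes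
   [V / 2 - V k^2 / 2]. *)
pose e := k * t; have e0 : 0 < e by rewrite mulr_gt0.
(* Pointwise split of [expR (t w)]: for [w] in [[lo, hi]] it is at most [expR (t hi)]; above [hi] or
   below [lo] it is dominated by the weight tilted further by [e] in that direction. *)
have key : cosh t ^+ n <= expR (t * hi) * p
    + expR (- (e * hi)) * cosh (t + e) ^+ n + expR (e * lo) * cosh (t - e) ^+ n.
  rewrite -!coin_avg_expR /p -!coin_avgZ -!coin_avgD; apply: le_coin_avg => s _.
  set w := coin_walk s.
  have E1 : expR (- (e * hi)) * expR ((t + e) * w) = expR (t * w) * expR (e * (w - hi)).
    by rewrite -!expRD; congr expR; ring.
  have E2 : expR (e * lo) * expR ((t - e) * w) = expR (t * w) * expR (e * (lo - w)).
    by rewrite -!expRD; congr expR; ring.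
  rewrite E1 E2.
  have w0 := expR_gt0 (t * w).
  have := expR_ge0 (e * (w - hi)); have := expR_ge0 (e * (lo - w)).
  case: (leP lo w) => [lw|wl]; last first.
    have : 1 <= expR (e * (lo - w)) by rewrite expR_ge1 // mulr_ge0 //; lra.
    rewrite mulr0; nra.
  rewrite mulr1; have := expR_ge0 (t * hi).
  case: (leP w hi) => [wh|hw].
    have : expR (t * w) <= expR (t * hi) by rewrite ler_expR ler_pM2l.
    nra.
  have : 1 <= expR (e * (w - hi)) by rewrite expR_ge1 // mulr_ge0 //; lra.
  nra.
have B (u v : R) : u + n%:R * (v ^+ 2 / 2) = V / 2 - V * k ^+ 2 / 2 ->
    expR u * cosh v ^+ n <= expR (V / 2) * expR (- (V * k ^+ 2 / 2)).
  move=> uv; rewrite -expRD -uv expRD ler_pM2l ?expR_gt0 //.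
  by rewrite expRM_natl lerXn2r ?nnegrE ?expR_ge0 ?cosh_le // ltW // cosh_gt0.
have b1 : expR (- (e * hi)) * cosh (t + e) ^+ n <=
    expR (V / 2) * expR (- (V * k ^+ 2 / 2)).
  by apply: B; rewrite /e /hi /V; field.
have b2 : expR (e * lo) * cosh (t - e) ^+ n <=
    expR (V / 2) * expR (- (V * k ^+ 2 / 2)).
  by apply: B; rewrite /e /lo /V; field.
have b3 : expR (V / 2) * expR (- (1 / 4)) <= cosh t ^+ n.
  apply: (@le_trans _ _ (expR (t ^+ 2 / 2 - t ^+ 4 / 4) ^+ n)).
    rewrite -expRD -expRM_natl ler_expR /V; lra.
  by rewrite lerXn2r ?nnegrE ?expR_ge0 ?cosh_ge // ltW // cosh_gt0.
have b4 : 3 / 4 <= expR (- (1 / 4)) :> R.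
  by apply: le_trans (expR_ge1Dx _); lra.
have b5 : expR (- (V * k ^+ 2 / 2)) <= 1 / 8.
  rewrite expRN mul1r lef_pV2 ?posrE ?expR_gt0 //.
  apply: le_trans (expR_ge1Dx _); rewrite /V; lra.
have v0 := expR_gt0 (V / 2).
(* Relative to [expR (V / 2)] the total mass is at least [3/4] and each error at most [1/8], which
   leaves [1/2]. The constant [14] is there for the [1/8]: [1 + 14 / 2 = 8]. *)
have main : expR (V / 2) / 2 <= expR (t * hi) * p by nra.
have -> : - (n%:R * t ^+ 2 / 2 * (1 + 2 * k)) = V / 2 - t * hi.
  by rewrite /V /hi; field.
by rewrite expRD expRN mulrAC ler_pdivrMr ?expR_gt0 // mulrC [p * _]mulrC // mulrC.
Qed.

End coin_average.

(** * Fair coins on a probability space and the Borel-Cantelli arguments *)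

Section fair_coins.
Context (d : measure_display) (T : measurableType d) (R : realType).
Variable P : probability T R.
Implicit Types (c : nat -> T -> bool) (n : nat) (t : T).

(** Prescribing the probability of every finite prefix expresses fairness and independence at
    once. *)
Definition fair_coins c : Prop :=
  (forall k, measurable [set t | c k t]) /\
  (forall s, P [set t | mkseq (c^~ t) (size s) == s]
             = ((2^-1) ^+ size s)%:E).

Definition coin_sum c n t : R := coin_walk (mkseq (c^~ t) n).

Lemma measurable_coins c (j n : nat) (Phi : pred (seq bool)) :
  (forall k, measurable [set t | c k t]) ->
  measurable [set t | Phi (mkseq (fun i => c (j + i)%N t) n)].
Proof.
move=> mc; elim: n Phi => [|n IH] Phi.
  rewrite /mkseq /=; case: (Phi [::]).
    by rewrite (_ : [set _ | _] = setT)//; apply/seteqP; split.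
  by rewrite (_ : [set _ | _] = set0)//; apply/seteqP; split.
have -> : [set t | Phi (mkseq (fun i => c (j + i)%N t) n.+1)] =
   ([set t | c (j + n)%N t] `&`
     [set t | Phi (rcons (mkseq (fun i => c (j + i)%N t) n) true)]) `|`
   (~` [set t | c (j + n)%N t] `&`
     [set t | Phi (rcons (mkseq (fun i => c (j + i)%N t) n) false)]).
  apply/seteqP; split => t /=; rewrite mkseqS; case: (c (j + n)%N t).
  - by left.
  - by right.
  - by case=> [[]|[]].
  - by case=> [[]|[]].
apply: measurableU; apply: measurableI.
- exact: mc.
- exact: (IH (fun s => Phi (rcons s true))).
- exact/measurableC/mc.
- exact: (IH (fun s => Phi (rcons s false))).
Qed.

Lemma measurable_coin_prefix c n (Phi : pred (seq bool)) :
  (forall k, measurable [set t | c k t]) ->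
  measurable [set t | Phi (mkseq (c^~ t) n)].
Proof. by move=> mc; exact: (@measurable_coins c 0). Qed.

Lemma mkseq_cons A (f : nat -> A) n :
  mkseq f n.+1 = f 0%N :: mkseq (fun i => f i.+1) n.
Proof. by rewrite /mkseq /= -[1%N]addn0 iotaDl -map_comp. Qed.

(** The fixed prefix [p] is what the induction needs: the next toss is appended to it, and the two
    extended prefixes are disjoint events. *)
Lemma fair_coins_cond c (p : seq bool) n (Phi : pred (seq bool)) :
  fair_coins c ->
  P [set t | (mkseq (c^~ t) (size p) == p) &&
             Phi (mkseq (fun i => c (size p + i)%N t) n)] =
  ((2^-1) ^+ size p * coin_avg n (fun s => (Phi s)%:R))%:E.
Proof.
move=> [mc fc]; elim: n p Phi => [|n IH] p Phi.
  rewrite /mkseq /=; case: (Phi [::]).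
    under eq_set do rewrite andbT.
    by rewrite mulr1 fc.
  under eq_set do rewrite andbF.
  by rewrite mulr0 (_ : [set _ | _] = set0) ?measure0 //; apply/seteqP; split.
have split_set : [set t | (mkseq (c^~ t) (size p) == p) &&
      Phi (mkseq (fun i => c (size p + i)%N t) n.+1)] =
   [set t | (mkseq (c^~ t) (size (rcons p true)) == rcons p true) &&
      (Phi \o cons true) (mkseq (fun i => c (size (rcons p true) + i)%N t) n)]
   `|`
   [set t | (mkseq (c^~ t) (size (rcons p false)) == rcons p false) &&
      (Phi \o cons false) (mkseq (fun i => c (size (rcons p false) + i)%N t) n)].
  apply/seteqP; split => t /=; rewrite (mkseq_cons _ n) !size_rcons
    mkseqS /= addn0 !eqseq_rcons.
  - rewrite (@eq_mkseq _ (fun i => c (size p + i.+1)%N t)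
      (fun i => c ((size p).+1 + i)%N t)); last by move=> i; rewrite addnS.
    by move=> /andP[-> H]; case: (c (size p) t) H => H; [left|right].
  - rewrite (@eq_mkseq _ (fun i => c (size p + i.+1)%N t)
      (fun i => c ((size p).+1 + i)%N t)); last by move=> i; rewrite addnS.
    by case => /andP[/andP[-> /eqP ->]].
have mB q (Psi : pred (seq bool)) : measurable
    [set t | (mkseq (c^~ t) (size q) == q) &&
             Psi (mkseq (fun i => c (size q + i)%N t) n)].
  rewrite (_ : [set _ | _] = [set t | mkseq (c^~ t) (size q) == q] `&`
    [set t | Psi (mkseq (fun i => c (size q + i)%N t) n)]); last first.
    by apply/seteqP; split => t /=; [move/andP|case=> -> ->].
  apply: measurableI; last exact: (measurable_coins (size q) n Psi mc).
  exact: (measurable_coin_prefix (size q) (fun s => s == q) mc).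
rewrite split_set measureU; first last.
- apply/seteqP; split => t //= [].
  by rewrite !size_rcons mkseqS !eqseq_rcons => /andP[/andP[_ /eqP ->]] _ /andP[/andP[]].
- exact: mB.
- exact: mB.
transitivity (\sum_(b <- [:: true; false])
    (2^-1 ^+ size (rcons p b) * coin_avg n (fun s => (Phi (b :: s))%:R) : R)%:E)%E.
  rewrite !big_cons big_nil adde0; congr (_ + _)%E.
    exact: (IH (rcons p true) (Phi \o cons true)).
  exact: (IH (rcons p false) (Phi \o cons false)).
rewrite !big_cons big_nil adde0 !size_rcons -EFinD exprSr /=.
by congr (_%:E); rewrite -mulrDr -mulrA [2^-1 * _]mulrC.
Qed.

Lemma fair_coins_prob c n (Phi : pred (seq bool)) : fair_coins c ->
  P [set t | Phi (mkseq (c^~ t) n)] = (coin_avg n (fun s => (Phi s)%:R))%:E.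
Proof.
by move=> fc; have := fair_coins_cond [::] n Phi fc; rewrite /= mul1r.
Qed.

Lemma mkseq_negb c n t :
  mkseq (fun k => ~~ c k t) n = map negb (mkseq (c^~ t) n).
Proof. by rewrite /mkseq -map_comp. Qed.

Lemma fair_coinsN c : fair_coins c -> fair_coins (fun k t => ~~ c k t).
Proof.
move=> [mc fc]; split=> [k|s].
  rewrite (_ : [set _ | _] = ~` [set t | c k t]); first exact: measurableC.
  by apply/seteqP; split => t /= /negP.
rewrite -(size_map negb s) -fc; set m := size _.
have inv : cancel (map negb) (map negb).
  by move=> u; rewrite -map_comp map_id_in // => b _; rewrite /= negbK.
congr (P _); apply/seteqP; split => t /=; rewrite mkseq_negb.
- by move=> /eqP <-; rewrite inv.
- by move=> /eqP ->; rewrite inv.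
Qed.

Lemma coin_sumN c n t :
  coin_sum (fun k t => ~~ c k t) n t = - coin_sum c n t.
Proof.
rewrite /coin_sum mkseq_negb /coin_walk big_map -sumrN.
by apply: eq_bigr => -[] _ //=; rewrite opprK.
Qed.

(** First Borel-Cantelli lemma, with summability supplied by a telescoping majorant: the series of
    probabilities is at most [v 0]. *)
Lemma summable_ae_notin (F : nat -> set T) (v : nat -> R) :
  (forall k, measurable (F k)) -> (forall k, 0 <= v k) ->
  (forall k, (P (F k) <= (v k - v k.+1)%:E)%E) ->
  {ae P, forall t, exists n, forall j, (n <= j)%N -> ~ F j t}.
Proof.
move=> mF v0 Fv.
exists (lim_sup_set F); split.
- by apply: bigcap_measurable => // k _; apply: bigcup_measurable => j _; exact: mF.
- apply: lim_sup_set_cvg0 => //.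
  apply: (@le_lt_trans _ _ (v 0%N)%:E); last exact: ltry.
  apply: lime_le; first by apply: is_cvg_nneseries.
  apply: nearW => n; apply: (@le_trans _ _ (\sum_(0 <= k < n) (v k - v k.+1))%:E).
    rewrite -sumEFin; apply: lee_sum => k _; exact: Fv.
  rewrite lee_fin -[X in X <= _]opprK -sumrN.
  under eq_bigr do rewrite opprB.
  by rewrite telescope_sumr // opprB lerBlDr lerDl.
- move=> t /= H n _; apply: contrapT => H'; apply: H; exists n => j nj Fj.
  by apply: H'; exists j.
Qed.

(** Induction on [M]: the earlier conditions see only the first [N M] tosses, so the last block
    splits off by [coin_avg_cat]. *)
Lemma coin_avg_blocks (N : nat -> nat) (Phi : nat -> pred (seq bool)) K M :
  (forall k, (N k <= N k.+1)%N) -> (K <= M)%N ->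
  coin_avg (N M) (fun s => (all (fun k =>
      Phi k (drop (N k) (take (N k.+1) s))) (index_iota K M))%:R) =
  \prod_(K <= k < M)
    coin_avg (N k.+1 - N k) (fun s => (Phi k s)%:R) :> R.
Proof.
move=> NS; elim: M => [|M IH] KM.
  by rewrite big_geq // /index_iota sub0n /= coin_avg_cst.
have [KM'|KM'] := leqP K M; last first.
  have -> : K = M.+1 by lia.
  by rewrite big_geq // /index_iota subnn /= coin_avg_cst.
rewrite big_nat_recr //= -IH //.
rewrite -{1}(subnKC (NS M)) -coin_avg_cat.
apply: eq_coin_avg => s ss.
have -> : index_iota K M.+1 = rcons (index_iota K M) M.
  by rewrite /index_iota subSn // -addn1 iotaD cats1 subnKC.
rewrite all_rcons andbC.
have -> : take (N M.+1) s = s.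
  by rewrite take_oversize // ss subnKC.
rewrite (eq_in_all (a2 := fun k => Phi k (drop (N k) (take (N k.+1) (take (N M) s))))).
  by case: all => //=; rewrite ?mul1r ?mul0r.
move=> k; rewrite mem_index_iota => /andP[_ kM].
rewrite take_takel //.
have : {homo N : x y / (x <= y)%N} by apply: homo_leq => //; exact: leq_trans.
exact.
Qed.

Lemma harmonic_unbounded (K : nat) (B : R) :
  exists2 M, (K <= M)%N & B < \sum_(K <= k < M) (k.+1%:R)^-1.
Proof.
apply: contrapT => H; apply: (@dvg_harmonic R).
apply: nondecreasing_is_cvgn.
  by apply/nondecreasing_series => n _ _; exact: harmonic_ge0.
exists (series (@harmonic R) K + `|B|) => _ [n _ <-].
have [nK|Kn] := leqP n K.
  apply: (@le_trans _ _ (series (@harmonic R) K)); last by rewrite lerDl.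
  by apply/nondecreasing_series => // m _ _; exact: harmonic_ge0.
have {}H : \sum_(K <= k < n) (k.+1%:R)^-1 <= B.
  by rewrite leNgt; apply/negP => ?; apply: H; exists n => //; exact: ltnW.
rewrite /series /= (@big_cat_nat _ _ _ K) //=; last exact: ltnW.
by rewrite lerD2l (le_trans H) // ler_norm.
Qed.

(** Second Borel-Cantelli lemma for disjoint blocks: all blocks from [K] to [M] fail with
    probability at most the product of [1 - dl / (k + 1)], hence at most [expR] of minus [dl] times
    a divergent harmonic sum. *)
Lemma fair_coins_blocks_io c (N : nat -> nat) (Phi : nat -> pred (seq bool))
    (dl : R) (k0 : nat) :
  fair_coins c -> (forall k, (N k <= N k.+1)%N) -> 0 < dl ->
  (forall k, (k0 <= k)%N ->
     dl / k.+1%:R <= coin_avg (N k.+1 - N k) (fun s => (Phi k s)%:R)) ->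
  {ae P, forall t, forall K, exists2 k, (K <= k)%N &
     Phi k (drop (N k) (mkseq (c^~ t) (N k.+1)))}.
Proof.
move=> fc NS dl0 Hp; apply: ae_foralln => K0.
pose K := maxn K0 k0.
pose A M := [set t | all (fun k =>
  ~~ Phi k (drop (N k) (take (N k.+1) (mkseq (c^~ t) (N M))))) (index_iota K M)].
have mA M : measurable (A M).
  by apply: (measurable_coin_prefix (N M) (fun s => all (fun k =>
  ~~ Phi k (drop (N k) (take (N k.+1) s))) (index_iota K M))); case: fc.
exists (\bigcap_M A M); split.
- exact: bigcap_measurable.
- have mI : measurable (\bigcap_M A M) by exact: bigcap_measurable.
  have fin : P (\bigcap_M A M) \is a fin_num by exact: fin_num_measure.
  suff : P (\bigcap_M A M) = 0%E by [].
  apply/eqP; rewrite eq_le measure_ge0 andbT -(fineK fin) lee_fin leNgt.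
  apply/negP => p0; set p := fine _ in p0.
  have bnd M : (K <= M)%N -> p <= expR (- (dl * \sum_(K <= k < M) (k.+1%:R)^-1)).
    move=> KM; rewrite -lee_fin fineK //.
    apply: (@le_trans _ _ (P (A M))).
      by apply: le_measure; rewrite ?inE //; exact: bigcap_inf.
    rewrite (fair_coins_prob (N M) (fun s => all (fun k =>
      ~~ Phi k (drop (N k) (take (N k.+1) s))) (index_iota K M)) fc) lee_fin.
    rewrite (coin_avg_blocks (fun k s => ~~ Phi k s) NS KM).
    rewrite mulr_sumr -sumrN expR_sum !big_nat.
    apply: ler_prod => k /andP[Kk _].
    rewrite coin_avg_ge0 /=; last by move=> s _; case: (Phi k s).
    have := Hp k; rewrite (leq_trans (leq_maxr K0 k0) Kk) => /(_ isT) pk.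
    apply: le_trans (expR_ge1Dx _).
    have : coin_avg (N k.+1 - N k) (fun s => (Phi k s)%:R) +
      coin_avg (N k.+1 - N k) (fun s => (~~ Phi k s)%:R) = 1 :> R.
      rewrite -coin_avgD -[RHS](coin_avg_cst (N k.+1 - N k) 1).
      by apply: eq_coin_avg => s _; case: (Phi k s); rewrite ?addr0 ?add0r.
    move: pk; cbv beta; set X := coin_avg _ _; set Y := coin_avg _ _.
    by set Z := dl / _; clearbody X Y Z; lra.
  (* A harmonic sum beyond [p^-1 / dl] makes the exponential bound smaller than [p], a
     contradiction. *)
  have [M KM HM] := harmonic_unbounded K (p^-1 / dl).
  have := bnd M KM; rewrite expRN leNgt => /negP; apply.
  rewrite -[ltRHS]invrK ltf_pV2 ?posrE ?expR_gt0 ?invr_gt0 //.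
  apply: (@lt_le_trans _ _ (1 + dl * \sum_(K <= k < M) (k.+1%:R)^-1)).
    by move: HM; rewrite ltr_pdivrMr // mulrC; lra.
  exact: expR_ge1Dx.
- move=> t /= H M _; apply/allP => k; rewrite mem_index_iota => /andP[Kk kM].
  apply/negP => Hk; apply: H; exists k; first exact: leq_trans (leq_maxl _ _) Kk.
  have kM' : (N k.+1 <= N M)%N.
    have : {homo N : x y / (x <= y)%N} by apply: homo_leq => //; exact: leq_trans.
    exact.
  by move: Hk; rewrite /mkseq -map_take take_iota (minn_idPl kM').
Qed.

End fair_coins.

(** * The iterated-logarithm normalisation *)

Section lil_scale.
Context {R : realType}.
Implicit Types x y : R.

(** The classical [sqrt (2 m ln ln m)] at [m = 2 x], with [ln ln x] in place of the asymptotically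
    equivalent [ln ln (2 x)]. *)
Definition lil_fun x : R := 2 * Num.sqrt (x * ln (ln x)).

Definition lil_scale (n : nat) : R := lil_fun n%:R.

Lemma lil_fun_ge0 x : 0 <= lil_fun x.
Proof. by rewrite mulr_ge0 // sqrtr_ge0. Qed.

Lemma lil_fun_sqr x : 1 <= ln x -> lil_fun x ^+ 2 = 4 * x * ln (ln x).
Proof.
move=> x1; rewrite exprMn sqr_sqrtr; last first.
  rewrite mulr_ge0 ?ln_ge0 // leNgt; apply/negP => /ltW /ln0 x0.
  by move: x1; rewrite x0; lra.
by rewrite -natrX mulrA.
Qed.

Lemma ln_ge1_gt0 x : 1 <= ln x -> 0 < x.
Proof.
by move=> x1; rewrite ltNge; apply/negP => /ln0 x0; move: x1; rewrite x0; lra.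
Qed.

Lemma le_lil_fun x y : 1 <= ln x -> x <= y -> lil_fun x <= lil_fun y.
Proof.
move=> x1 xy; have x0 := ln_ge1_gt0 x1.
have lxy : ln x <= ln y by rewrite ler_ln // posrE; lra.
rewrite ler_pM2l // ler_sqrt; last first.
  by rewrite mulr_ge0 ?ln_ge0 //; lra.
apply: ler_pM => //; rewrite ?ln_ge0 //; try lra.
by rewrite ler_ln // posrE; lra.
Qed.

(* The Riemann series of exponent [1 + e] is dominated by a telescoping one. *)
Lemma expR_telescope (e x : R) : 0 < e -> 1 <= x ->
  expR (- ((1 + e) * ln x)) <=
  (2 + e) / e * (expR (- (e * ln x)) - expR (- (e * ln (x + 1)))).
Proof.
move=> e0 x1.
have lx : ln (x + 1) = ln x + ln (1 + x^-1).
  rewrite -lnM ?posrE //; [congr ln; field|..]; try lra.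
  by rewrite addr_gt0 // invr_gt0; lra.
have x0 : 0 < x by lra.
have l1 : (x + 1)^-1 <= ln (1 + x^-1).
  have -> : 1 + x^-1 = (1 - (x + 1)^-1)^-1 by field; lra.
  rewrite lnV ?posrE; last by rewrite subr_gt0 invf_lt1; lra.
  rewrite lerNr; apply: le_ln1Dx; rewrite ltrN2 invf_lt1; lra.
have -> : - ((1 + e) * ln x) = - (e * ln x) - ln x by ring.
have -> : - (e * ln (x + 1)) = - (e * ln x) - e * ln (1 + x^-1).
  by rewrite lx; ring.
rewrite 2!expRD !expRN lnK ?posrE //.
set A := (expR (e * ln x))^-1; have A0 : 0 < A by rewrite invr_gt0 expR_gt0.
rewrite -[X in _ * (X - _)]mulr1 -mulrBr mulrCA ler_pM2l //.
have b : (expR (e * ln (1 + x^-1)))^-1 <= (x + 1) / (x + 1 + e).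
  rewrite -[leRHS]invrK lef_pV2 ?posrE ?expR_gt0 ?invr_gt0 ?divr_gt0 //; try lra.
  apply: le_trans (expR_ge1Dx _).
  have -> : ((x + 1) / (x + 1 + e))^-1 = 1 + e * (x + 1)^-1 by field; lra.
  by rewrite lerD2l ler_pM2l.
apply: (@le_trans _ _ ((2 + e) / e * (1 - (x + 1) / (x + 1 + e)))); last first.
  by rewrite ler_pM2l ?divr_gt0 //; lra.
(* The factor [(2 + e) / e] reduces the claim to [x + 1 + e <= (2 + e) x], that is, to [1 <= x]. *)
have -> : (2 + e) / e * (1 - (x + 1) / (x + 1 + e)) = (2 + e) / (x + 1 + e).
  by field; lra.
rewrite ler_pdivlMr; last lra.
rewrite mulrC ler_pdivrMr; nra.
Qed.

End lil_scale.

(** * Upper half of the law of the iterated logarithm for coins *)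

Section lil.
Context (d : measure_display) (T : measurableType d) (R : realType).
Variable P : probability T R.
Implicit Types (c : nat -> T -> bool) (n : nat) (t : T).

Local Notation S := (@coin_sum d T R).

(** On the grid [q^m] with [q = 1 + e], the event [F] has the walk reach [q * lil_fun (q^m)] within
    [2 q^(m+1)] tosses. The maximal inequality bounds it by [expR (- q ln ln (q^m))], of order
    [m^-(1+e)], which is summable. *)
Lemma lil_upper c (e : R) : fair_coins P c -> 0 < e ->
  {ae P, forall t, \forall n \near \oo,
    S c (n.*2) t <= (1 + e) * lil_scale n}.
Proof.
move=> fc e0; pose q := 1 + e; have q1 : 1 < q by rewrite /q; lra.
have q0 : 0 < q by lra.
have lq : 0 < ln q by exact: ln_gt0.
have lnq k : ln (q ^+ k) = k%:R * ln q by rewrite lnXn // mulr_natl.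
(* From [k0] on, [ln ln (q^k) > 1]: the levels are positive and [lil_fun] is monotone there. *)
pose k0 := (Num.truncn (expR 1 / ln q)).+1.
have k0P k : (k0 <= k)%N -> 1 < ln (ln (q ^+ k)).
  move=> kk; have hk : expR 1 < k%:R * ln q.
    rewrite -ltr_pdivrMr //; apply: (@lt_le_trans _ _ k0%:R).
      by have /truncn_itv/andP[] : 0 <= expR 1 / ln q by rewrite divr_ge0 ?expR_ge0 // ltW.
    by rewrite ler_nat.
  rewrite -ltr_expR lnK ?lnq // posrE; apply: le_lt_trans hk; exact: expR_ge0.
have lnk1 k : (k0 <= k)%N -> 1 <= ln (q ^+ k).
  move=> /k0P h; rewrite leNgt; apply/negP => h1.
  by have := ln_le0 (ltW h1); lra.
pose a k := q * lil_fun (q ^+ k).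
pose N k := Num.truncn (2 * q ^+ k.+1).
have N_le k : (N k)%:R <= 2 * q ^+ k.+1.
  by have /truncn_itv/andP[] : 0 <= 2 * q ^+ k.+1 by rewrite mulr_ge0 ?exprn_ge0 // ltW.
have N_gt0 k : (0 < N k)%N.
  by rewrite /N truncn_gt0; have := @exprn_ege1 R k.+1 q (ltW q1); lra.
pose F k := [set t | hits (a (k0 + k)%N) (mkseq (c^~ t) (N (k0 + k)%N))].
(* Since [ln (q^m) = m ln q], the constant collects the power of [ln q] and the factor of
   [expR_telescope]. *)
pose C := expR (- ((1 + e) * ln (ln q))) * ((2 + e) / e).
have C0 : 0 < C by rewrite mulr_gt0 ?expR_gt0 // divr_gt0 //; lra.
pose v k := C * expR (- (e * ln (k0 + k)%:R)).
have tel k : (P (F k) <= (v k - v k.+1)%:E)%E.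
  have kk : (k0 <= k0 + k)%N by exact: leq_addr.
  rewrite (fair_coins_prob _ (hits (a (k0 + k)%N)) fc) lee_fin.
  move: kk; rewrite /v addnS; move: (k0 + k)%N => m k0m.
  have m1 : 1 <= m%:R :> R by rewrite (ler_nat _ 1); apply: leq_trans k0m.
  have a0 : 0 < a m.
    rewrite mulr_gt0 // mulr_gt0 // sqrtr_gt0 mulr_gt0 ?exprn_gt0 //.
    by have := k0P _ k0m; lra.
  apply: (le_trans (coin_avg_hits a0 (N_gt0 m))).
  apply: (@le_trans _ _ (expR (- ((1 + e) * ln (ln (q ^+ m)))))).
    rewrite ler_expR lerN2 /a exprMn lil_fun_sqr; last exact: lnk1.
    rewrite ler_pdivlMr; last by rewrite mulr_gt0 // ltr0n.
    have L0 : 0 < ln (ln (q ^+ m)) by have := k0P _ k0m; lra.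
    apply: (@le_trans _ _ ((1 + e) * ln (ln (q ^+ m)) * (2 * (2 * q ^+ m.+1)))).
      rewrite ler_pM2l; last by rewrite mulr_gt0.
      by rewrite ler_pM2l.
    by rewrite le_eqVlt; apply/orP; left; apply/eqP; rewrite exprS -/q; ring.
  rewrite lnq lnM ?posrE //; last lra.
  rewrite mulrDr opprD addrC expRD /C -mulrBr -mulrA ler_pM2l ?expR_gt0 //.
  by rewrite -(natr1 m); apply: expR_telescope.
have mF k : measurable (F k).
  by apply: (measurable_coin_prefix (N (k0 + k)%N) (hits (a (k0 + k)%N))); case: fc.
have v0 k : 0 <= v k by rewrite mulr_ge0 ?expR_ge0 // ltW.
apply: filterS (summable_ae_notin mF v0 tel) => t [n0 Hn0].
have qn0 : 0 < q ^+ (k0 + n0) by exact: exprn_gt0.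
exists (Num.truncn (q ^+ (k0 + n0))).+1 => // n /= nn.
have nq : q ^+ (k0 + n0) <= n%:R.
  have /truncn_itv/andP[_ h] := ltW qn0.
  by apply: ltW; apply: lt_le_trans h _; rewrite ler_nat.
have n0' : 0 < n%:R :> R by apply: lt_le_trans nq.
have y0 : (k0 + n0)%:R <= ln n%:R / ln q.
  by rewrite ler_pdivlMr // -lnq ler_ln ?posrE.
have yge0 : 0 <= ln n%:R / ln q by apply: le_trans y0; exact: ler0n.
(* The grid cell of [n]: [q^m <= n < q^(m+1)]. A violation at time [2 n] therefore lies within the
   [N m] tosses of the event for [m]. *)
pose m := Num.truncn (ln n%:R / ln q).
have /andP[m1 m2] := truncn_itv yge0; rewrite -/m in m1 m2.
have km : (k0 + n0 <= m)%N by rewrite truncn_ge_nat.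
have qm : q ^+ m <= n%:R.
  by rewrite -ler_ln ?posrE ?exprn_gt0 // lnq -ler_pdivlMr.
have qm1 : n%:R < q ^+ m.+1.
  by rewrite -ltr_ln ?posrE ?exprn_gt0 // lnq -ltr_pdivrMr.
have k0m : (k0 <= m)%N by apply: leq_trans km; exact: leq_addr.
rewrite leNgt; apply/negP => H.
apply: (Hn0 (m - k0)%N); first by rewrite leq_subRL.
rewrite /F subnKC //; apply: (@hits_take _ _ _ (n.*2)).
rewrite /mkseq -map_take take_iota (minn_idPl _); last first.
  rewrite truncn_ge_nat; last by rewrite mulr_ge0 // exprn_ge0 // ltW.
  by rewrite -muln2 natrM mulrC ler_pM2l // ltW.
apply: le_trans (ltW H); rewrite -/q ler_pM2l //.
by apply: le_lil_fun => //; exact: lnk1.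
Qed.

End lil.

(** * Lower half of the law of the iterated logarithm for coins *)

Section lil_lower.
Context (d : measure_display) (T : measurableType d) (R : realType).
Variable P : probability T R.
Implicit Types (c : nat -> T -> bool) (n : nat) (t : T).

Local Notation S := (@coin_sum d T R).

(** From [ln x = 2 ln (sqrt x) <= 2 sqrt x]. With the next lemma it yields the condition
    [n t^4 <= 1] of [coin_avg_tail] on the blocks. *)
Lemma ln_sqr_le (x : R) : 1 <= x -> ln x ^+ 2 <= 4 * x.
Proof.
move=> x1; have x0 : 0 < x by lra.
have s1 : Num.sqrt x ^+ 2 = x by rewrite sqr_sqrtr // ltW.
have s0 : 0 < Num.sqrt x by rewrite sqrtr_gt0.
have L : ln x <= 2 * Num.sqrt x.
  by rewrite -{1}s1 lnXn // -[ln _ *+ 2]mulr_natl ler_pM2l // ltW // ln_sublinear.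
have L0 : 0 <= ln x by exact: ln_ge0.
by rewrite -[X in _ <= 4 * X]s1; nra.
Qed.

Lemma expn_ge_linear (rho k : nat) : (4 <= rho)%N -> (4 <= k)%N ->
  (16 * k.+1 <= rho ^ k)%N.
Proof.
move=> r4 k4; apply: (@leq_trans (4 ^ k)); last by rewrite leq_exp2r //; lia.
elim: k k4 => [//|k IH]; rewrite leq_eqVlt => /predU1P[<- //|k4].
have := IH k4; rewrite expnS; lia.
Qed.

(** With [rho = r^2], the tosses from [2 rho^k] to [2 rho^(k+1)] form independent blocks.
    [coin_avg_tail] with tolerance [ka = 1 / rho] gives success probability at least
    [expR (- L k) / 2], a constant over [k + 1], so infinitely many blocks succeed. *)
Lemma lil_lower_blocks c (r : nat) : fair_coins P c -> (2 <= r)%N ->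
  {ae P, forall t, forall K, exists2 k, (K <= k)%N &
    (1 - 2 / r%:R) * @lil_scale R ((r ^ 2) ^ k.+1) <=
    S c ((r ^ 2) ^ k.+1).*2 t - S c ((r ^ 2) ^ k).*2 t}.
Proof.
move=> fc r2; pose rho := (r ^ 2)%N.
have r4 : (4 <= rho)%N by rewrite /rho; nia.
have rhoS k : (rho ^ k <= rho ^ k.+1)%N by rewrite leq_exp2l //; lia.
have rho0 : 0 < rho%:R :> R by rewrite ltr0n; lia.
have rho4 : 4 <= rho%:R :> R by rewrite (ler_nat _ 4).
pose ka : R := rho%:R^-1.
have ka0 : 0 < ka by rewrite invr_gt0.
have ka1 : ka <= 1 / 4 by rewrite mul1r lef_pV2 ?posrE.
(* Chosen so that, with [m th^2 = 2 cc L], the exponent [m th^2 / 2 * (1 + 2 ka)] is exactly [L]. *)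
pose cc : R := (1 + 2 * ka)^-1.
have cc0 : 0 < cc by rewrite invr_gt0; lra.
have cc1 : cc <= 1 by rewrite invf_le1; lra.
have ccl : 1 - 2 * ka <= cc.
  by rewrite /cc -[leRHS]mul1r ler_pdivlMr; nra.
(* That is, [expR 1 <= 4], which follows from [1/2 <= expR (- 1/2)]. *)
have lrho : 1 <= ln (rho%:R : R).
  rewrite -ler_expR lnK ?posrE //; apply: le_trans rho4.
  have := expR_ge1Dx (- (1/2) : R); rewrite expRN => h.
  have e1 := expR_gt0 (1/2 : R).
  have : expR (1/2 : R) <= 2.
    rewrite -[leRHS]invrK -[leLHS]invrK lef_pV2 ?posrE ?invr_gt0 //; lra.
  have -> : expR 1 = expR (1/2) * expR (1/2) :> R by rewrite -expRD; congr expR; lra.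
  nra.
pose L k : R := ln (ln (rho ^ k.+1)%:R).
have lrk k : ln ((rho ^ k.+1)%:R : R) = k.+1%:R * ln rho%:R.
  by rewrite natrX lnXn // mulr_natl.
pose N k := (rho ^ k).*2.
have NS k : (N k <= N k.+1)%N by rewrite leq_double.
pose m k := (N k.+1 - N k)%N.
have mE k : (m k)%:R = 2 * (rho ^ k.+1)%:R * (1 - ka) :> R.
  rewrite /m natrB // /N -!muln2 !natrM expnS natrM /ka; field; lra.
have m0 k : 0 < (m k)%:R :> R.
  rewrite mE mulr_gt0 //; last lra.
  by rewrite mulr_gt0 // ltr0n expn_gt0; lia.
pose th k : R := Num.sqrt (2 * cc * L k / (m k)%:R).
pose x k : R := (m k)%:R * th k * (1 - ka).
(* The [4] serves [expn_ge_linear]; the other term makes [2 cc L ka^2 >= 14], as [coin_avg_tail]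
   demands. *)
pose k0 := (4 + (Num.truncn (expR (7 / (cc * ka ^+ 2)))).+1)%N.
have Lge k : (k0 <= k)%N -> 7 / (cc * ka ^+ 2) <= L k.
  move=> kk; rewrite -ler_expR lnK; last first.
    by rewrite posrE lrk mulr_gt0 //; lra.
  rewrite lrk; apply: (@le_trans _ _ k.+1%:R); last first.
    by rewrite ler_peMr.
  have /truncn_itv/andP[_ h] := expR_ge0 (7 / (cc * ka ^+ 2)).
  by apply: (le_trans (ltW h)); rewrite ler_nat; lia.
have Lgt0 k : (k0 <= k)%N -> 0 < L k.
  move=> /Lge; apply: lt_le_trans.
  by rewrite divr_gt0 // mulr_gt0 // exprn_gt0.
have thsq k : (k0 <= k)%N -> (m k)%:R * th k ^+ 2 = 2 * cc * L k.
  move=> kk; rewrite sqr_sqrtr; last first.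
    by rewrite divr_ge0 // ?ltW // !mulr_gt0 // Lgt0.
  by rewrite mulrC divfK // gt_eqF.
have prob k : (k0 <= k)%N -> (2 * ln (rho%:R : R))^-1 / k.+1%:R <=
   coin_avg (m k) (fun s => (x k <= coin_walk s)%R%:R).
  move=> kk; have Lk := Lgt0 _ kk.
  have := @coin_avg_tail R (m k) (th k) ka; rewrite thsq //.
  have -> : 2 * cc * L k / 2 * (1 + 2 * ka) = L k.
    by rewrite /cc; field; lra.
  rewrite -/(x k).
  have -> : expR (- L k) / 2 = (2 * ln (rho%:R : R))^-1 / k.+1%:R.
    rewrite expRN lnK ?posrE; last by rewrite lrk mulr_gt0 //; lra.
    rewrite lrk !invfM; ring.
  apply.
  - by rewrite sqrtr_gt0 divr_gt0 // !mulr_gt0.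
  - by rewrite ka0 /=; lra.
  - have -> : (m k)%:R * th k ^+ 4 = ((m k)%:R * th k ^+ 2) ^+ 2 / (m k)%:R.
      by field; rewrite gt_eqF.
    rewrite thsq // ler_pdivrMr // mul1r.
    apply: (@le_trans _ _ (4 * L k ^+ 2)).
      have -> : (2 * cc * L k) ^+ 2 = 4 * L k ^+ 2 * cc ^+ 2 by ring.
      rewrite ler_piMr ?mulr_ge0 ?sqr_ge0 //; nra.
    have k1 : 1 <= k.+1%:R :> R by rewrite (ler_nat _ 1).
    have := @ln_sqr_le (k.+1%:R * ln rho%:R).
    rewrite mulr_ege1 // => /(_ isT); rewrite -lrk -/(L k) lrk => h.
    have lr : ln (rho%:R : R) <= rho%:R by rewrite ltW // ln_sublinear.
    have k4 : (4 <= k)%N by apply: leq_trans kk; exact: leq_addr.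
    have := expn_ge_linear r4 k4; rewrite -(ler_nat R) natrM => h2.
    rewrite mE expnS natrM.
    have h3 : k.+1%:R * ln rho%:R <= k.+1%:R * rho%:R :> R by rewrite ler_pM2l //; lra.
    have h4 : 16 * k.+1%:R * rho%:R <= rho%:R * (rho ^ k)%:R :> R.
      by rewrite mulrC ler_pM2l.
    have h5 : 0 <= rho%:R * (rho ^ k)%:R :> R by rewrite mulr_ge0 // ltW.
    move: h h3 h4 h5; clear -ka1; set A := L k; set B := k.+1%:R; set C := _ * (rho ^ k)%:R.
    set D := B * ln _; rewrite -mulrA; set E := B * rho%:R.
    nra.
  - have := Lge _ kk; rewrite ler_pdivrMr ?mulr_gt0 ?exprn_gt0 //; nra.
have dl0 : 0 < (2 * ln (rho%:R : R))^-1 by rewrite invr_gt0; lra.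
have := fair_coins_blocks_io (Phi := fun k s => x k <= coin_walk s) fc NS dl0 prob.
apply: filterS => t H K.
have [k Kk] := H (maxn K k0).
have k0k : (k0 <= k)%N by apply: leq_trans Kk; exact: leq_maxr.
move=> Hk; exists k; first by apply: leq_trans Kk; exact: leq_maxl.
have -> : S c ((r ^ 2) ^ k.+1).*2 t - S c ((r ^ 2) ^ k).*2 t =
    coin_walk (drop (N k) (mkseq (c^~ t) (N k.+1))).
  rewrite /coin_sum -/rho -/(N k.+1) -/(N k).
  rewrite -[in LHS](cat_take_drop (N k) (mkseq _ (N k.+1))) coin_walk_cat.
  rewrite /mkseq -map_take take_iota (minn_idPl (NS k)).
  by rewrite addrAC subrr add0r.
apply: le_trans Hk; rewrite -/rho /x.
have Lk := Lgt0 _ k0k.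
(* The level [x k] is [lil_scale (rho^(k+1))] times [sqrt u * (1 - ka)] with [u = cc (1 - ka) <= 1].
   As [sqrt u >= u], this factor is at least [(1 - 2 ka) (1 - ka)^2 >= 1 - 4 ka], and
   [ka <= 1 / (2 r)]. *)
have -> : (m k)%:R * th k = Num.sqrt (2 * cc * L k * (m k)%:R).
  have {1}-> : (m k)%:R = Num.sqrt ((m k)%:R ^+ 2) :> R.
    by rewrite sqrtr_sqr gtr0_norm.
  by rewrite -sqrtrM ?sqr_ge0 //; congr Num.sqrt; field; rewrite gt_eqF.
have -> : 2 * cc * L k * (m k)%:R =
    2 ^+ 2 * ((rho ^ k.+1)%:R * L k) * (cc * (1 - ka)) by rewrite mE; ring.
have pos : 0 <= (rho ^ k.+1)%:R * L k by rewrite mulr_ge0 // ltW.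
have u0 : 0 < cc * (1 - ka) by rewrite mulr_gt0 // subr_gt0; lra.
rewrite sqrtrM; last by rewrite mulr_ge0.
rewrite sqrtrM // sqrtr_sqr ger0_norm // -/(lil_fun (rho ^ k.+1)%:R).
rewrite -/(@lil_scale R (rho ^ k.+1)).
have a0 : 0 <= @lil_scale R (rho ^ k.+1) by exact: lil_fun_ge0.
move: a0; move: (@lil_scale R (rho ^ k.+1)) => a a0.
rewrite mulrC -[leRHS]mulrA; apply: ler_wpM2l => //.
have su : cc * (1 - ka) <= Num.sqrt (cc * (1 - ka)).
  set u := cc * (1 - ka) in u0 *.
  have u1 : u <= 1 by rewrite /u; nra.
  have s2 : Num.sqrt u ^+ 2 = u by rewrite sqr_sqrtr // ltW.
  have s1 : Num.sqrt u <= 1 by rewrite -sqrtr1 ler_sqrt.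
  rewrite -[X in X <= _]s2; have := sqrtr_ge0 u; nra.
apply: (@le_trans _ _ (cc * (1 - ka) * (1 - ka))); last first.
  by rewrite ler_pM2r // subr_gt0; lra.
have r0 : 2 <= r%:R :> R by rewrite (ler_nat _ 2).
have kar : ka <= (1 / 2) / r%:R.
  rewrite /ka /rho natrX expr2 invfM ler_pM2r ?invr_gt0; [|lra].
  by rewrite mul1r lef_pV2 ?posrE //; lra.
have -> : 2 / r%:R = 4 * ((1 / 2) / r%:R) :> R by lra.
move: kar; set y := (1 / 2) / r%:R => kar; clearbody y.
apply: (@le_trans _ _ ((1 - 2 * ka) * (1 - ka) * (1 - ka))); first by nra.
by rewrite -!mulrA ler_pM2r ?mulr_gt0 ?subr_gt0 //; lra.
Qed.

(** The factor [r^2] leaves the square root as [r], and [ln ln] only grows. Hence the walk before a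
    block is negligible for large [r]. *)
Lemma lil_scale_prev (r k : nat) : (2 <= r)%N -> (4 <= k)%N ->
  @lil_scale R ((r ^ 2) ^ k) <= @lil_scale R ((r ^ 2) ^ k.+1) / r%:R.
Proof.
move=> r2 k4; have r0 : 2 <= r%:R :> R by rewrite (ler_nat _ 2).
have lr : 1 / 2 <= ln (r%:R : R).
  have : ln (2 : R) <= ln r%:R by rewrite ler_ln ?posrE //; lra.
  apply: le_trans; rewrite -[leRHS]opprK -lnV ?posrE //.
  have -> : (2^-1 : R) = 1 + (- (1/2)) by lra.
  rewrite lerNr; apply: (le_trans (le_ln1Dx _)); lra.
have lnk j : (4 <= j)%N -> 1 <= ln (((r ^ 2) ^ j)%:R : R).
  move=> j4; rewrite -expnM natrX lnXn; last lra.
  rewrite -[ln _ *+ _]mulr_natl.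
  have j8 : 4 <= (2 * j)%:R :> R by rewrite (ler_nat _ 4); lia.
  by apply: le_trans (ler_pM _ _ j8 lr) => //; lra.
rewrite ler_pdivlMr; last lra.
rewrite /lil_scale /lil_fun -mulrA ler_pM2l //.
rewrite -[X in _ * X](@ger0_norm _ r%:R) // -sqrtr_sqr -sqrtrM; last first.
  by rewrite mulr_ge0 // ln_ge0 // lnk.
rewrite ler_sqrt; last by rewrite mulr_ge0 // ln_ge0 // lnk //; lia.
rewrite mulrAC -natrX -natrM -expnSr ler_pM2l; last first.
  by rewrite ltr0n expn_gt0; lia.
have pos j : 0 < ((r ^ 2) ^ j)%:R :> R by rewrite ltr0n !expn_gt0; lia.
have lnk0 j : (4 <= j)%N -> 0 < ln (((r ^ 2) ^ j)%:R : R).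
  by move=> /lnk; apply: lt_le_trans.
rewrite ler_ln ?posrE ?lnk0 //; last exact: leq_trans (leqnSn k).
by rewrite ler_ln ?posrE // ler_nat leq_exp2l //; nia.
Qed.

(** Countably many tolerances [1 / (j + 1)] and ratios [r] share one almost sure event. For the
    lower half, the sum at a block's end is its increment plus the sum at its start. *)
Theorem lil_coins c : fair_coins P c -> {ae P, forall t,
  (forall e : R, 0 < e -> \forall n \near \oo,
     S c n.*2 t <= (1 + e) * @lil_scale R n) /\
  (forall e : R, 0 < e -> forall n0, exists2 n, (n0 <= n)%N &
     (1 - e) * @lil_scale R n <= S c n.*2 t)}.
Proof.
move=> fc.
have up : {ae P, forall t, forall j, \forall n \near \oo,
     S c n.*2 t <= (1 + j.+1%:R^-1) * @lil_scale R n}.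
  by apply: ae_foralln => j; apply: lil_upper => //; rewrite invr_gt0.
(* Flipped coins with tolerance [1] bound the sum at the start of a block below by
   [- 2 lil_scale]. *)
have dn := lil_upper (fair_coinsN fc) (@ltr01 R).
have lo : {ae P, forall t, forall r K, (2 <= r)%N -> exists2 k, (K <= k)%N &
    (1 - 2 / r%:R) * @lil_scale R ((r ^ 2) ^ k.+1) <=
    S c ((r ^ 2) ^ k.+1).*2 t - S c ((r ^ 2) ^ k).*2 t}.
  apply: ae_foralln => r; have [r2|r2] := leqP 2 r; last first.
    by apply: aeW => t K; lia.
  apply: filterS (lil_lower_blocks fc r2) => t H K _; exact: H.
apply: filterS3 up dn lo => t up dn lo; split=> [e e0|e e0 n0].
  have [j je] : exists j : nat, j.+1%:R^-1 < e.
    exists (Num.truncn e^-1); rewrite -[ltRHS]invrK ltf_pV2 ?posrE ?invr_gt0 //.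
    by have /truncn_itv/andP[] : 0 <= e^-1 by rewrite invr_ge0 ltW.
  apply: filterS (up j) => n /le_trans; apply.
  by rewrite ler_wpM2r ?lil_fun_ge0 // lerD2l ltW.
have [M _ HM] := dn.
(* The loss is [2 / r] in the increment and [2 / r] from the past; [6 / r <= e] covers both, and
   [.+2] ensures [2 <= r]. *)
pose r := (Num.truncn (6 / e)).+2.
have r0 : 2 <= r%:R :> R by rewrite (ler_nat _ 2).
have re : 6 / r%:R <= e.
  rewrite ler_pdivrMr; last lra.
  rewrite mulrC -ler_pdivrMr //.
  have /truncn_itv/andP[_ h] : 0 <= 6 / e by rewrite divr_ge0 // ltW.
  by apply: (le_trans (ltW h)); rewrite ler_nat.
have [//|k Kk Hk] := lo r (n0 + M + 4)%N _.
have kpow j : (j <= (r ^ 2) ^ j)%N by rewrite ltnW // ltn_expl // /r; nia.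
exists ((r ^ 2) ^ k.+1)%N; first by apply: leq_trans (kpow _); lia.
have := HM ((r ^ 2) ^ k)%N; rewrite /= coin_sumN.
have -> : (M <= (r ^ 2) ^ k)%N by apply: leq_trans (kpow _); lia.
move=> /(_ isT) Hm.
have := @lil_scale_prev r k isT; have -> : (4 <= k)%N by lia.
move=> /(_ isT).
have a0 : 0 <= @lil_scale R ((r ^ 2) ^ k.+1) by exact: lil_fun_ge0.
move: re Hk Hm a0; set a := @lil_scale R _; set b := @lil_scale R _.
set X := S c _ t; set Y := S c _ t.
have ir : 0 < r%:R^-1 :> R by rewrite invr_gt0; lra.
move: ir; set i := r%:R^-1; clearbody X Y a b i; nra.
Qed.

End lil_lower.

(** * Distances and one-step probabilities on the comb *)

Section comb_geometry.

Lemma lattice_le_comb_path u v n :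
  comb_path u v n -> `|u.1 - v.1| + `|u.2 - v.2| <= n%:Z.
Proof.
move=> [p [pp <- <-]] {v n}.
elim: p u pp => [|w p IH] u /=; first by move=> _; lia.
move=> /andP[/andP[+ _] /IH]; rewrite /lattice_edge; move: (last w p) => v.
by move=> /eqP; lia.
Qed.

Lemma lattice_le_comb_dist u v :
  `|u.1 - v.1| + `|u.2 - v.2| <= (comb_dist u v)%:Z.
Proof.
by apply: lattice_le_comb_path; rewrite /comb_dist; case: ex_minnP => n /asboolP.
Qed.

(** Walk along the tooth to the axis, then along the axis; subtracting [Num.sg] moves one unit
    towards zero. *)
Lemma comb_path_origin u : comb_path u (0, 0) (`|u.1| + `|u.2|)%N.
Proof.
have step u' v : comb_edge u' v -> comb_path u' v 1.
  by move=> e; exists [:: v]; rewrite /= e.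
have horiz (n : nat) (x : int) : `|x|%N = n -> comb_path (x, 0) (0, 0) n.
  elim: n x => [|n IH] x xn.
    by exists [::]; split => //=; congr pair; lia.
  rewrite -add1n; pose y := x - Num.sg x.
  apply: (@comb_path_cat _ (y, 0)); last by apply: IH; rewrite /y; lia.
  by apply: step; rewrite /comb_edge /lattice_edge /y /=; lia.
case: u => x y /=.
have vert (n : nat) (z : int) : `|z|%N = n -> comb_path (x, z) (x, 0) n.
  elim: n z => [|n IH] z zn.
    by exists [::]; split => //=; congr pair; lia.
  rewrite -add1n; pose y' := z - Num.sg z.
  apply: (@comb_path_cat _ (x, y')); last by apply: IH; rewrite /y'; lia.
  by apply: step; rewrite /comb_edge /lattice_edge /y' /=; lia.
by rewrite addnC; apply: comb_path_cat (vert _ _ erefl) (horiz _ _ erefl).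
Qed.

Lemma comb_dist_le u v :
  (comb_dist u v <= `|u.1| + `|u.2| + (`|v.1| + `|v.2|))%N.
Proof.
rewrite /comb_dist; case: ex_minnP => n _; apply; apply/asboolP.
apply: comb_path_cat (comb_path_origin u) _.
exact/comb_path_sym/comb_path_origin.
Qed.

Definition signed_sum (sg : bool * bool) (u : vertex) : int :=
  (if sg.1 then u.1 else - u.1) + (if sg.2 then u.2 else - u.2).

Lemma comb_dist_ge_signed_sum u v :
  signed_sum (true, true) u - signed_sum (true, true) v <= (comb_dist u v)%:Z.
Proof. by have := lattice_le_comb_dist u v; rewrite /signed_sum /=; lia. Qed.

(** The signs follow those of [u] and oppose those of [v], so the difference is the sum of the two
    l1 norms, the length of the route through the origin. *)
Lemma comb_dist_le_signed_sum u v : exists sg sg',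
  (comb_dist u v)%:Z <= signed_sum sg u - signed_sum sg' v.
Proof.
exists (0 <= u.1, 0 <= u.2), (v.1 < 0, v.2 < 0).
have := comb_dist_le u v; rewrite /signed_sum /=.
by case: (leP 0 u.1); case: (leP 0 u.2); case: (ltP v.1 0); case: (ltP v.2 0); lia.
Qed.

(** All four lattice neighbours: off the axis the horizontal ones have [comb_step] zero, so one list
    serves every vertex. *)
Definition lattice_nbrs (u : vertex) : seq vertex :=
  [:: (u.1, u.2 + 1); (u.1, u.2 - 1); (u.1 + 1, u.2); (u.1 - 1, u.2)].

Lemma uniq_lattice_nbrs u : uniq (lattice_nbrs u).
Proof. by rewrite /lattice_nbrs /= !inE !xpair_eqE; lia. Qed.

Definition up_step sg (u v : vertex) : bool :=
  signed_sum sg v - signed_sum sg u == 1.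

Lemma signed_sum_step (R : realType) sg u v : v \in lattice_nbrs u ->
  coin_sign (up_step sg u v) = (signed_sum sg v - signed_sum sg u)%:~R :> R.
Proof.
move=> uv; rewrite /coin_sign /up_step.
have : signed_sum sg v - signed_sum sg u = 1 \/
       signed_sum sg v - signed_sum sg u = -1.
  move: uv; case: u sg => x y [[] []]; rewrite !inE /signed_sum;
    by move=> /or4P[] /eqP -> /=; lia.
by case=> ->.
Qed.

(** On the axis two of four neighbours of weight [1/4] raise the signed sum; off it, one of two of
    weight [1/2]. The law of the coin thus does not depend on the position. *)
Lemma sum_comb_step_up (R : realType) sg b u :
  \sum_(v <- lattice_nbrs u | up_step sg u v == b) comb_step R u v = 2^-1.
Proof.
case: u => x y; rewrite /lattice_nbrs !big_cons big_nil /=.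
have e1 : comb_step R (x, y) (x, y + 1) = if y == 0 then 4^-1 else 2^-1.
  by rewrite /comb_step /comb_edge /lattice_edge /= ifT //; lia.
have e2 : comb_step R (x, y) (x, y - 1) = if y == 0 then 4^-1 else 2^-1.
  by rewrite /comb_step /comb_edge /lattice_edge /= ifT //; lia.
have e3 : comb_step R (x, y) (x + 1, y) = if y == 0 then 4^-1 else 0.
  rewrite /comb_step /comb_edge /lattice_edge /= eqxx /=.
  have -> : (`|x - (x + 1)| + `|y - y| == 1) by lia.
  by case: (y == 0).
have e4 : comb_step R (x, y) (x - 1, y) = if y == 0 then 4^-1 else 0.
  rewrite /comb_step /comb_edge /lattice_edge /= eqxx /=.
  have -> : (`|x - (x - 1)| + `|y - y| == 1) by lia.
  by case: (y == 0).
rewrite e1 e2 e3 e4.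
have u1 f : up_step f (x, y) (x, y + 1) = f.2.
  by case: f => [[] []]; rewrite /up_step /signed_sum /=; lia.
have u2 f : up_step f (x, y) (x, y - 1) = ~~ f.2.
  by case: f => [[] []]; rewrite /up_step /signed_sum /=; lia.
have u3 f : up_step f (x, y) (x + 1, y) = f.1.
  by case: f => [[] []]; rewrite /up_step /signed_sum /=; lia.
have u4 f : up_step f (x, y) (x - 1, y) = ~~ f.1.
  by case: f => [[] []]; rewrite /up_step /signed_sum /=; lia.
by rewrite u1 u2 u3 u4; case: sg => [[] []]; case: b; case: (y == 0) => /=; lra.
Qed.

Lemma sum_comb_step (R : realType) u :
  \sum_(v <- lattice_nbrs u) comb_step R u v = 1.
Proof.
rewrite (bigID (fun v => up_step (true, true) u v == true)) /=.
rewrite sum_comb_step_up (eq_bigl (fun v => up_step (true, true) u v == false)).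
  by rewrite sum_comb_step_up; lra.
by move=> v; rewrite eqb_id eqbF_neg.
Qed.

End comb_geometry.

(** * Conditioning a comb walk on its past *)

Section comb_walk_coins.
Context (d : measure_display) (T : measurableType d) (R : realType).
Variable P : probability T R.
Implicit Types (X : nat -> T -> vertex) (w : nat -> vertex) (sg : bool * bool).

Let p (A : set T) : R := fine (P A).

Let pE A : measurable A -> P A = (p A)%:E.
Proof. by move=> mA; rewrite fineK // fin_num_measure. Qed.

Let pU A B : measurable A -> measurable B -> A `&` B = set0 ->
  p (A `|` B) = p A + p B.
Proof.
by move=> mA mB AB; rewrite /p measureU // fineD // fin_num_measure.
Qed.

Let le_p A B : measurable A -> measurable B -> A `<=` B -> p A <= p B.
Proof.
move=> mA mB AB; apply: fine_le; rewrite ?fin_num_measure //.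
by apply: le_measure; rewrite ?inE.
Qed.

Let p_ge0 A : 0 <= p A. Proof. exact: fine_ge0. Qed.

Let p_sum_in (f : T -> vertex) (A : set T) (s : seq vertex) :
  (forall B, measurable (f @^-1` B)) -> measurable A -> uniq s ->
  p (A `&` [set t | f t \in s]) = \sum_(v <- s) p (A `&` [set t | f t = v]).
Proof.
move=> mf mA; elim: s => [|v s IH] /=.
  move=> _; rewrite big_nil (_ : _ `&` _ = set0) /p ?measure0 //.
  by apply/seteqP; split => t [].
move=> /andP[vs us]; rewrite big_cons -IH // -pU.
- congr p; apply/seteqP; split => t /=; rewrite inE.
    by move=> [At /orP[/eqP|] ?]; [left|right].
  by move=> [[At ->]|[At ->]]; rewrite ?eqxx ?orbT.
- by apply: measurableI => //; exact: (mf [set v]).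
- by apply: measurableI => //; exact: (mf [set u | u \in s]).
- by apply/seteqP; split => t // [[_ /= ->] [_ /=]]; rewrite (negbTE vs).
Qed.

Lemma measurable_history X n w :
  (forall n B, measurable (X n @^-1` B)) -> measurable (history X n w).
Proof.
move=> mX; rewrite (_ : history X n w =
  \bigcap_k [set t | (k <= n)%N -> X k t = w k]).
  apply: bigcap_measurable => // k _; case: (leqP k n) => kn.
    rewrite (_ : [set _ | _] = X k @^-1` [set w k]) //.
    by apply/seteqP; split => t //=; exact.
  by rewrite (_ : [set _ | _] = setT) //; apply/seteqP; split.
by apply/seteqP; split => t /= H k; [move=> _; exact: H|exact: H].
Qed.

Definition extend_path w n (v : vertex) : nat -> vertex :=
  fun k => if k == n.+1 then v else w k.

Lemma history_extend X n w v :
  history X n.+1 (extend_path w n v) =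
  history X n w `&` [set t | X n.+1 t = v].
Proof.
apply/seteqP; split => t /=.
  move=> H; split=> [k kn|]; last by rewrite H // /extend_path eqxx.
  by rewrite H ?(leq_trans kn) // /extend_path ltn_eqF.
by move=> [H H'] k; rewrite leq_eqVlt /extend_path => /predU1P[->|kn];
  rewrite ?eqxx // ltn_eqF // H.
Qed.

(** The product form of the transition law also covers null histories, where both sides vanish. *)
Lemma comb_walk_history_step X n w v : comb_walk P X ->
  p (history X n w `&` [set t | X n.+1 t = v]) =
  p (history X n w) * comb_step R (w n) v.
Proof.
move=> [mX _ tr]; have mH := measurable_history n w mX.
have mv : measurable [set t | X n.+1 t = v] by exact: (mX n.+1 [set v]).
have hE : history X n (extend_path w n v) = history X n w.
  by apply/seteqP; split => t H k kn; have := H k kn;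
    rewrite /extend_path ltn_eqF.
have [H0|H0] := eqVneq (P (history X n w)) 0%E.
  rewrite {2}/p H0 mul0r; apply/eqP; rewrite eq_le p_ge0 andbT.
  have -> : 0 = p (history X n w) by rewrite /p H0.
  by apply: le_p => //; exact: measurableI.
have := tr n (extend_path w n v); rewrite hE => /(_ H0).
rewrite /cond_prob /extend_path eqxx ltn_eqF // setIC => <-.
rewrite mulrC divfK //.
by move: H0; apply: contra_neq => H0; rewrite pE // /p H0.
Qed.

(** The weights of the four neighbours sum to one, so leaving them after a given history is a null
    event, and so is its part inside [A]. *)
Lemma comb_walk_nbrs X n w A : comb_walk P X -> measurable A ->
  A `<=` history X n w ->
  p A = \sum_(v <- lattice_nbrs (w n)) p (A `&` [set t | X n.+1 t = v]).
Proof.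
move=> cX mA AH; have [mX _ _] := cX; have mH := measurable_history n w mX.
pose U := [set t | X n.+1 t \in lattice_nbrs (w n)].
have mU : measurable U by exact: (mX n.+1 [set v | v \in lattice_nbrs (w n)]).
rewrite -p_sum_in ?uniq_lattice_nbrs // -/U.
have pD B : measurable B -> p B = p (B `&` U) + p (B `\` U).
  move=> mB; rewrite -pU; [|exact: measurableI|exact: measurableD|].
  - by rewrite -setIUr setUv setIT.
  - by apply/seteqP; split => t // [[_ ?] [_]].
have HU : p (history X n w `\` U) = 0.
  have := pD _ mH; rewrite p_sum_in ?uniq_lattice_nbrs //.
  under eq_bigr do rewrite comb_walk_history_step //.
  by rewrite -mulr_sumr sum_comb_step mulr1; lra.
have : p (A `\` U) <= 0.
  by rewrite -HU; apply: le_p; [exact: measurableD|exact: measurableD|exact: setSD].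
rewrite [LHS]pD //; have := p_ge0 (A `\` U); lra.
Qed.

Definition step_coin X sg (k : nat) (t : T) : bool :=
  up_step sg (X k t) (X k.+1 t).

End comb_walk_coins.

Lemma measurable_step_coin d (T : measurableType d) (X : nat -> T -> vertex) sg k :
  (forall n B, measurable (X n @^-1` B)) ->
  measurable [set t | step_coin X sg k t].
Proof.
move=> mX; rewrite (_ : [set _ | _] = \bigcup_(u : vertex)
  (X k @^-1` [set u] `&` X k.+1 @^-1` [set v | up_step sg u v])).
  apply: countable_bigcupT_measurable; first exact: countableP.
  by move=> u; apply: measurableI; exact: mX.
apply/seteqP; split => t /=; first by exists (X k t).
by move=> [u _ /= [<-]].
Qed.

(** * Fair coins from comb walks and their interleaving *)

Section comb_walk_fair.
Context (d : measure_display) (T : measurableType d) (R : realType).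
Variable P : probability T R.
Implicit Types (X : nat -> T -> vertex) (w : nat -> vertex) (sg : bool * bool).

(** Induction on [s] for all [n] and [w]: each next vertex with the right first coin extends the
    history by one step, and these vertices have total weight [1/2]. *)
Lemma history_coins X sg (s : seq bool) n w : comb_walk P X ->
  fine (P (history X n w `&`
    [set t | mkseq (fun j => step_coin X sg (n + j)%N t) (size s) == s])) =
  fine (P (history X n w)) * 2^-1 ^+ size s.
Proof.
move=> cX; have [mX _ _] := cX.
have mc k : measurable [set t | step_coin X sg k t] by exact: measurable_step_coin.
elim: s n w => [|b s IH] n w.
  rewrite (_ : _ `&` _ = history X n w) ?mulr1 //.
  by apply/seteqP; split => t //= [].
set A := _ `&` _.
have mA : measurable A.
  apply: measurableI; first exact: measurable_history.
  exact: (measurable_coins n (size (b :: s)) (fun s' => s' == b :: s) mc).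
rewrite (comb_walk_nbrs cX mA (w := w) (n := n)); last by move=> t [].
rewrite (bigID (fun v => up_step sg (w n) v == b)) /=.
rewrite [X in _ + X]big1 ?addr0; last first.
  move=> v vb; rewrite (_ : _ `&` _ = set0) ?measure0 //.
  apply/seteqP; split => t // [[H /= /eqP E] Xv]; move: vb.
  move: E; rewrite mkseq_cons addn0 => -[<- _].
  by rewrite /step_coin Xv H // eqxx.
rewrite exprS mulrA [_ * 2^-1]mulrC -{1}(sum_comb_step_up R sg b (w n)).
rewrite !mulr_suml; apply: eq_bigr => v /eqP vb.
rewrite [comb_step _ _ _ * _]mulrC -(comb_walk_history_step n w v cX).
rewrite -history_extend -IH history_extend; congr (fine (P _)).
have E t : history X n w t -> X n.+1 t = v ->
   (mkseq (fun j => step_coin X sg (n + j) t) (size (b :: s)) == b :: s) =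
   (mkseq (fun j => step_coin X sg (n.+1 + j) t) (size s) == s).
  move=> H Xv; rewrite /= mkseq_cons addn0 eqseq_cons.
  rewrite {1}/step_coin Xv H // vb eqxx /=; congr (_ == _).
  by apply: eq_mkseq => j; rewrite addnS.
apply/seteqP; split => t /=.
  by move=> [[H E'] Xv]; rewrite -(E _ H Xv).
by move=> [[H Xv]]; rewrite -(E _ H Xv).
Qed.

Lemma fair_step_coin X sg : comb_walk P X -> fair_coins P (step_coin X sg).
Proof.
move=> cX; have [mX X0 _] := cX.
have mc k : measurable [set t | step_coin X sg k t] by exact: measurable_step_coin.
split=> // s; pose w := fun _ : nat => (0, 0) : vertex.
have H0 : history X 0 w = [set t | X 0%N t = (0, 0)].
  apply/seteqP; split => t /=; first by move=> /(_ 0%N) ->.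
  by move=> H k; rewrite leqn0 => /eqP ->.
have mH := measurable_history 0 w mX.
set A := [set t | _].
have mA : measurable A by exact: (measurable_coin_prefix _ (fun s' => s' == s) mc).
have HA : P (history X 0 w `&` A) = P A.
  apply/eqP; rewrite eq_le; apply/andP; split.
    by apply: le_measure; rewrite ?inE //; exact: measurableI.
  have -> : P A = (P (A `&` history X 0 w) + P (A `\` history X 0 w))%E.
    rewrite -measureU; [|exact: measurableI|exact: measurableD|].
    - by congr (P _); rewrite -setIUr setUv setIT.
    - by apply/seteqP; split => t // [[_ ?] [_]].
  have -> : P (A `\` history X 0 w) = 0%E.
    apply/eqP; rewrite eq_le measure_ge0 andbT.
    apply: (@le_trans _ _ (P (~` history X 0 w))).
      apply: le_measure; rewrite ?inE //; first exact: measurableD.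
      exact: measurableC.
    have -> : P (~` history X 0 w) = 0%E; last by [].
    by rewrite probability_setC // H0 X0 subee.
  by rewrite adde0 setIC.
rewrite -HA -[LHS]fineK; last by rewrite fin_num_measure //; exact: measurableI.
rewrite (history_coins sg s 0 w cX) H0 X0.
by rewrite mul1r.
Qed.

Lemma ae_forall_countable (I : countType) (Q : I -> T -> Prop) :
  (forall i, {ae P, forall t, Q i t}) -> {ae P, forall t, forall i, Q i t}.
Proof.
move=> HQ; have : {ae P, forall t, forall k, oapp (Q ^~ t) True (unpickle k)}.
  apply: ae_foralln => k.
  by case: (unpickle k) => [i|] /=; [exact: HQ|apply: aeW].
by apply: filterS => t H i; have := H (pickle i); rewrite pickleK.
Qed.

(** Indexing the histories up to time [n] by finite sequences leaves only countably many null events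
    to discard. *)
Lemma ae_comb_walk_nbrs X : comb_walk P X ->
  {ae P, forall t, X 0%N t = (0, 0) /\
    forall n, X n.+1 t \in lattice_nbrs (X n t)}.
Proof.
move=> cX; have [mX X0 _] := cX.
have ae0 : {ae P, forall t, X 0%N t = (0, 0)}.
  have m0 : measurable [set t | X 0%N t = (0, 0)] by exact: (mX 0%N [set (0, 0)]).
  exists (~` [set t | X 0%N t = (0, 0)]); split => //.
    exact: measurableC.
  have -> : P (~` [set t | X 0%N t = (0, 0)]) = 0%E; last by [].
  by rewrite probability_setC // X0 subee.
suff aeS : {ae P, forall t, forall n, X n.+1 t \in lattice_nbrs (X n t)}.
  by apply: filterS2 ae0 aeS.
apply: ae_foralln => n.
pose H (s : seq vertex) := history X n (nth (0, 0) s).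
pose A s := H s `&` [set t | X n.+1 t \notin lattice_nbrs (nth (0, 0) s n)].
have mA s : measurable (A s).
  apply: measurableI; first exact: measurable_history.
  exact: (mX n.+1 [set v | v \notin lattice_nbrs (nth (0, 0) s n)]).
have aeA : {ae P, forall t, forall s, ~ A s t}.
  apply: ae_forall_countable => s.
  exists (A s); split; [exact: mA| |by move=> t /= /contrapT].
  rewrite -[LHS]fineK ?fin_num_measure //.
  have AH : A s `<=` history X n (nth (0, 0) s) by move=> t [].
  rewrite (comb_walk_nbrs cX (mA s) AH) big_seq big1 // => v vs.
  rewrite (_ : _ `&` _ = set0) ?measure0 //.
  by apply/seteqP; split => t // [[_ /= /negP h] Xv]; apply: h; rewrite Xv.
apply: filterS aeA => t HA; apply/negPn/negP => bad.
apply: (HA (mkseq (X^~ t) n.+1)); split => /=.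
  by move=> k kn; rewrite nth_mkseq // ltnS.
by rewrite nth_mkseq.
Qed.

(* The walk of [Y] enters with the opposite sign, so that the interleaved
   coins have partial sums [signed_sum sg (X n) - signed_sum sg' (Y n)]. *)
Definition pair_coin X Y sg sg' (k : nat) (t : T) : bool :=
  if odd k then ~~ step_coin Y sg' k./2 t else step_coin X sg k./2 t.

Lemma pair_coin_prefix X Y sg sg' (s : seq bool) t :
  (mkseq ((pair_coin X Y sg sg')^~ t) (size s) == s) =
  (mkseq ((step_coin X sg)^~ t) (uphalf (size s)) ==
     mkseq (fun k => nth false s k.*2) (uphalf (size s))) &&
  (mkseq ((step_coin Y sg')^~ t) (size s)./2 ==
     mkseq (fun k => ~~ nth false s k.*2.+1) (size s)./2).
Proof.
apply/idP/idP.
  move=> /eqP E; have nthE k : (k < size s)%N -> nth false s k = pair_coin X Y sg sg' k t.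
    by move=> ks; rewrite -[in LHS]E nth_mkseq.
  apply/andP; split; apply/eqP/eq_in_map => k; rewrite mem_iota add0n => /= ks.
    rewrite nthE /pair_coin ?odd_double ?doubleK //.
    by rewrite -gtn_uphalf_double.
  rewrite nthE /pair_coin /= ?odd_double ?uphalf_double ?negbK //.
  by rewrite -gtn_half_double.
move=> /andP[/eqP E1 /eqP E2]; apply/eqP; apply: (@eq_from_nth _ false).
  by rewrite size_mkseq.
rewrite size_mkseq => k ks; rewrite nth_mkseq // /pair_coin.
have kE := odd_double_half k.
move: ks; move: (k./2) kE => j; case: (odd k) => /= <- ks.
- have js : (j < (size s)./2)%N by rewrite gtn_half_double.
  have := congr1 (fun u => nth false u j) E2; rewrite !nth_mkseq // => ->.
  by rewrite negbK add1n.
- have js : (j < uphalf (size s))%N by rewrite gtn_uphalf_double.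
  by have := congr1 (fun u => nth false u j) E1; rewrite !nth_mkseq // => ->.
Qed.

(** The measurability proof is reused with the sigma-algebra generated by [X] in place of the
    ambient one. *)
Lemma process_events_coins X sg n (s : seq bool) :
  process_events X [set t | mkseq ((step_coin X sg)^~ t) n == s].
Proof.
pose G := [set A : set T | exists n (B : set vertex), A = X n @^-1` B].
have mX k (B : set vertex) :
    measurable ((X k : g_sigma_algebraType G -> vertex) @^-1` B).
  by apply: sub_sigma_algebra; exists k, B.
apply: (@measurable_coins _ (g_sigma_algebraType G) (step_coin X sg) 0 n
  (fun s' => s' == s)) => k.
exact: measurable_step_coin.
Qed.

(** A prefix event splits into one event of [X], at even positions, and one of [Y], at odd ones;
    independence multiplies their probabilities. *)
Lemma fair_pair_coin X Y sg sg' : comb_walk P X -> comb_walk P Y ->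
  (forall A B, process_events X A -> process_events Y B ->
     P (A `&` B) = (P A * P B)%E) ->
  fair_coins P (pair_coin X Y sg sg').
Proof.
move=> cX cY ind; have [mcX fX] := fair_step_coin sg cX.
have [mcY fY] := fair_step_coin sg' cY.
split=> [k|s].
  rewrite /pair_coin; case: (odd k); last exact: mcX.
  rewrite (_ : [set _ | _] = ~` [set t | step_coin Y sg' k./2 t]).
    exact: measurableC.
  by apply/seteqP; split => t /= /negP.
rewrite (_ : [set _ | _] =
  [set t | mkseq ((step_coin X sg)^~ t) (uphalf (size s)) ==
     mkseq (fun k => nth false s k.*2) (uphalf (size s))] `&`
  [set t | mkseq ((step_coin Y sg')^~ t) (size s)./2 ==
     mkseq (fun k => ~~ nth false s k.*2.+1) (size s)./2]); last first.
  by apply/seteqP; split => t /=; rewrite pair_coin_prefix => /andP.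
rewrite ind; [|exact: process_events_coins..].
have := fX (mkseq (fun k => nth false s k.*2) (uphalf (size s))).
have := fY (mkseq (fun k => ~~ nth false s k.*2.+1) (size s)./2).
rewrite !size_mkseq => -> ->; rewrite -EFinM -exprD uphalf_half -addnA addnn.
by rewrite odd_double_half.
Qed.

Lemma pair_coin_sum X Y sg sg' t :
  X 0%N t = (0, 0) /\ (forall n, X n.+1 t \in lattice_nbrs (X n t)) ->
  Y 0%N t = (0, 0) /\ (forall n, Y n.+1 t \in lattice_nbrs (Y n t)) ->
  forall n, coin_sum R (pair_coin X Y sg sg') n.*2 t =
    (signed_sum sg (X n t) - signed_sum sg' (Y n t))%:~R.
Proof.
move=> [X0 Xn] [Y0 Yn] n.
have signN b : coin_sign (~~ b) = - coin_sign b :> R.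
  by case: b => //=; rewrite /coin_sign opprK.
elim: n => [|n IH].
  rewrite /coin_sum /coin_walk big_nil X0 Y0 /signed_sum /=.
  by case: (sg.1); case: (sg.2); case: (sg'.1); case: (sg'.2).
rewrite /coin_sum doubleS !mkseqS -!cats1 !coin_walk_cat.
rewrite -/(coin_sum R _ _ t) IH /coin_walk !big_seq1 /pair_coin /= odd_double /=.
rewrite uphalf_double doubleK signN /step_coin.
rewrite !signed_sum_step // !rmorphB /=; ring.
Qed.

End comb_walk_fair.

(** * The limit superior of the maximal distance *)

Lemma limn_esup_eq1 (R : realType) (f : nat -> R) :
  (forall e, 0 < e -> \forall n \near \oo, f n <= 1 + e) ->
  (forall e, 0 < e -> forall n0, exists2 n, (n0 <= n)%N & 1 - e <= f n) ->
  limn_esup (fun n => (f n)%:E) = 1%E.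
Proof.
move=> ub lb; apply/eqP; rewrite eq_le; apply/andP; split.
  (* [limn_esup] is an infimum, over neighbourhoods of infinity, of suprema; the set where
     [f n <= 1 + e] is one such neighbourhood. *)
  apply/lee_addgt0Pr => e e0; apply: ge_ereal_inf.
  exists (ereal_sup ((fun n => (f n)%:E) @` [set n | f n <= 1 + e])).
    by exists [set n | f n <= 1 + e] => //; exact: ub.
  by apply: ge_ereal_sup => _ [n /= fn <-]; rewrite -EFinD lee_fin.
apply/lee_subgt0Pr => e e0; apply: le_ereal_inf_tmp => _ [V [n0 _ n0V] <-].
have [n nn fn] := lb e e0 n0; apply: le_ereal_sup_tmp; exists (f n)%:E.
  by exists n => //; exact: n0V.
by rewrite -EFinB lee_fin.
Qed.

(** Positivity holds beyond [expR 1], where [ln n > 1]. For [n <= 2] the scale is zero and the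
    quotient takes the default value of division. *)
Lemma lil_scale_gt0 (R : realType) : \forall n \near \oo, 0 < @lil_scale R n.
Proof.
have e0 := expR_gt0 (1 : R).
exists (Num.truncn (expR 1 : R)).+1 => // n /= nn.
have h : expR 1 < n%:R :> R.
  have /truncn_itv/andP[_ h] := ltW e0.
  by apply: lt_le_trans h _; rewrite ler_nat.
have n0 : 0 < n%:R :> R by lra.
have l1 : 1 < ln (n%:R : R) by rewrite -ltr_expR lnK.
by rewrite mulr_gt0 // sqrtr_gt0 mulr_gt0 // ln_gt0.
Qed.

Theorem theorem4p1 (d : measure_display) (T : measurableType d) (R : realType)
    (P : probability T R) (K : nat) (hK : (2 <= K)%N)
    (C : 'I_K -> nat -> T -> vertex)
    (hwalk : forall i, comb_walk P (C i))
    (hindep : independent_processes P C) :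
  {ae P, forall t,
    limn_esup (fun n : nat =>
      ((max_dist C n t)%:R /
        (2 * Num.sqrt (n%:R * ln (ln (n%:R : R)))))%:E) = 1%E}.
Proof.
have indep2 i j : i != j -> forall A B,
    process_events (C i) A -> process_events (C j) B ->
    P (A `&` B) = (P A * P B)%E.
  move=> ij A B pA pB.
  have := hindep [set i; j]%SET (fun k => if k == i then A else B).
  rewrite big_setU1 ?inE //= big_set1 eqxx eq_sym (negbTE ij).
  move=> <-; last first.
    move=> k; rewrite !inE => /orP[/eqP ->|/eqP ->]; first by rewrite eqxx.
    by rewrite eq_sym (negbTE ij).
  congr (P _); apply/seteqP; split => t /=.
    by move=> [At Bt] k _; case: eqP.
  move=> H; split; first by have := H i; rewrite eqxx; apply; rewrite /= !inE eqxx.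
  have := H j; rewrite eq_sym (negbTE ij); apply.
  by rewrite /= !inE eqxx orbT.
have lil (ij : 'I_K * 'I_K) (sg : (bool * bool) * (bool * bool)) :
   {ae P, forall t, ij.1 != ij.2 ->
  (forall e : R, 0 < e -> \forall n \near \oo,
     (signed_sum sg.1 (C ij.1 n t) - signed_sum sg.2 (C ij.2 n t))%:~R
       <= (1 + e) * @lil_scale R n) /\
  (forall e : R, 0 < e -> forall n0, exists2 n, (n0 <= n)%N &
     (1 - e) * @lil_scale R n <=
     (signed_sum sg.1 (C ij.1 n t) - signed_sum sg.2 (C ij.2 n t))%:~R)}.
  have [ijE|ijN] := boolP (ij.1 == ij.2); first by apply: aeW.
  have fc := fair_pair_coin sg.1 sg.2 (hwalk ij.1) (hwalk ij.2) (indep2 _ _ ijN).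
  apply: filterS3 (lil_coins fc) (ae_comb_walk_nbrs (hwalk ij.1))
    (ae_comb_walk_nbrs (hwalk ij.2)) => t [up lo] n1 n2 _.
  have E := @pair_coin_sum _ _ R _ _ sg.1 sg.2 t n1 n2.
  split=> e e0.
    by apply: filterS (up e e0) => n; rewrite E.
  by move=> n0; have [n nn] := lo e e0 n0; rewrite E => ?; exists n.
have {}lil := ae_forall_countable (fun ij => ae_forall_countable (lil ij)).
apply: filterS lil => t lil; apply: limn_esup_eq1 => e e0.
(* Pairs and signs are finitely many, so their eventual bounds hold simultaneously from some time
   on. *)
- have ub : \forall n \near \oo, forall (ij : 'I_K * 'I_K)
      (sg : (bool * bool) * (bool * bool)), ij.1 != ij.2 ->
     (signed_sum sg.1 (C ij.1 n t) - signed_sum sg.2 (C ij.2 n t))%:~R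
       <= (1 + e) * @lil_scale R n.
    apply: filter_forall => ij; apply: filter_forall => sg.
    have [ijE|ijN] := boolP (ij.1 == ij.2); first by apply: nearW.
    by have [up _] := lil ij sg ijN; apply: filterS (up e e0).
  apply: filterS2 ub (lil_scale_gt0 R) => n ub s0.
  rewrite -/(lil_fun n%:R) -/(lil_scale n) ler_pdivrMr //.
  apply: (big_ind (fun m : nat => m%:R <= (1 + e) * lil_scale n)) => [|x y hx hy|ij ijN].
  - by rewrite mulr_ge0 // ltW //; lra.
  - by case: (leqP x y).
  - have [sg [sg' le]] := comb_dist_le_signed_sum (C ij.1 n t) (C ij.2 n t).
    apply: le_trans (ub ij (sg, sg') ijN).
    by rewrite -[leLHS]/((comb_dist _ _)%:Z%:~R) ler_int.
(* One pair of walks, with all signs positive, already attains the lower bound. *)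
- move=> n0; pose i := Ordinal (ltnW hK); pose j := Ordinal hK.
  have [N _ HN] := lil_scale_gt0 R.
  have [_ /(_ e e0 (maxn n0 N))] := lil (i, j) ((true, true), (true, true)) isT.
  move=> [n]; rewrite geq_max => /andP[n0n Nn] /= H.
  exists n => //; rewrite -/(lil_fun n%:R) -/(lil_scale n).
  rewrite ler_pdivlMr; last exact: HN.
  apply: (le_trans H).
  apply: (@le_trans _ _ (comb_dist (C i n t) (C j n t))%:R).
    by rewrite -[leRHS]/((comb_dist _ _)%:Z%:~R) ler_int comb_dist_ge_signed_sum.
  rewrite ler_nat /max_dist.
  by rewrite (bigD1 (i, j)) //= leq_maxl.
Qed.
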